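(* For every proper metric space $X$ with $\mathrm{asdim}\, X<\infty$ one has $\mathrm{asInd}\, X=\mathrm{asdim}\, X$.
   Context: A metric space is proper if its closed balls are compact. Asymptotic dimension: $\mathrm{asdim}\, X\le n$ if for every $D>0$ there is a uniformly bounded cover $\mathcal U$ of $X$ with $\mathcal U=\mathcal U^0\cup\dots\cup\mathcal U^n$, where each $\mathcal U^i$ is $D$-disjoint (distinct members are at distance at least $D$); $\mathrm{asdim}\, X$ is the least such $n$. Higson corona: for a proper metric space $X$, a function $\varphi\colon X\to\mathbb R$ is slowly oscillating if for every $r>0$ the quantity $V_r(x)=\sup\{|\varphi(y)-\varphi(x)|: d(x,y)<r\}$ tends to $0$ as $x\to\infty$ (i.e. for each $\varepsilon>0$ there is a compact $K\subset X$ with $V_r(x)<\varepsilon$ for $x\notin K$). $\bar X$ is the compactification of $X$ corresponding to the family of all bounded continuous slowly oscillating functions, and $\nu X=\bar X\setminus X$ is the Higson corona. For $A\subset X$, the trace $A'$ is the intersection of the closure of $A$ in $\bar X$ with $\nu X$. Two subsets $A,B$ of $X$ are asymptotically disjoint if $\lim_{r\to\infty}d(A\setminus N_r(x_0),B\setminus N_r(x_0))=\infty$ for a base point $x_0$, where $N_r(x_0)$ is the open $r$-ball; equivalently $A'\cap B'=\emptyset$. A closed subset $C$ of a topological space $Z$ is a separator between disjoint $A,B\subset Z$ if $Z\setminus C=U\cup V$ with $U,V$ open in $Z$, $U\cap V=\emptyset$, $A\subset U$, $B\subset V$. A subset $C\subset X$ is an asymptotic separator between asymptotically disjoint $A_1,A_2\subset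 X$ if $C'$ is a separator in $\nu X$ between $A_1'$ and $A_2'$. Asymptotic inductive dimension $\mathrm{asInd}$ (for proper metric spaces): $\mathrm{asInd}\, X=-1$ iff $X$ is bounded; $\mathrm{asInd}\, X\le n$ iff for every asymptotically disjoint $A_1,A_2\subset X$ there is an asymptotic separator $C$ between $A_1$ and $A_2$ with $\mathrm{asInd}\, C\le n-1$ (here $C$ is closed in $X$, so that it is a proper metric space).
   Formalization: The space X is additionally assumed to be unbounded, because a nonempty bounded space (for example a single point) has asInd X = -1 but asdim X = 0, so the equality fails there. *)

(* Defs.v *)
From HB Require Import structures.
From mathcomp Require Import all_boot all_order all_algebra.
From mathcomp Require Import all_classical all_reals all_analysis.

Set Implicit Arguments.
Unset Strict Implicit.
Unset Printing Implicit Defensive.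

Import Order.TTheory GRing.Theory Num.Theory.
Import numFieldNormedType.Exports.

Local Open Scope classical_set_scope.
Local Open Scope ring_scope.

(* `set_type A` already carries the induced topology, uniformity and balls; we
   add the restricted distance, so that a subset of a metric space is itself a
   metric space. *)
Section SubMetric.
Context {R : realType} {X : metricType R} (A : set X).

Let subdist (x y : set_type A) : R := mdist (set_val x) (set_val y).

Let subdist_ge0 x y : 0 <= subdist x y.
Proof. exact: mdist_ge0. Qed.

Let subdist_positivity x y : subdist x y = 0 -> x = y.
Proof. by move=> /mdist_positivity /val_inj. Qed.

Let ballEsubdist x d : ball x d = [set y | subdist x y < d].
Proof.
have -> : ball x d = set_val @^-1` (ball (set_val x) d) by [].
by rewrite ballEmdist.
Qed.

HB.instance Definition _ := @PseudoMetric_isMetric.Build R (set_type A)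
  subdist subdist_ge0 subdist_positivity ballEsubdist.

End SubMetric.

Section MetricNotions.
Context {R : realType} {X : metricType R}.
Implicit Types A B U : set X.

Definition metric_bounded A :=
  exists M : R, forall x y, A x -> A y -> mdist x y <= M.

(* +oo when A or B is empty *)
Definition setdist A B : \bar R :=
  ereal_inf [set (mdist a b)%:E | a in A & b in B].

End MetricNotions.

(* The library's `closed_ball` is the closure of the open ball, which in a
   general metric space can be smaller than the set below. *)
Definition proper_metric (R : realType) (X : metricType R) :=
  forall (x : X) (r : R), compact [set y | mdist x y <= r].

Section AsymptoticDimension.
Context {R : realType} (X : metricType R).

Definition D_disjoint (D : R) (F : set (set X)) :=
  forall U V, F U -> F V -> U <> V -> (D%:E <= setdist U V)%E.

Definition uniformly_bounded (F : set (set X)) :=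
  exists M : R, forall U, F U -> forall x y, U x -> U y -> mdist x y <= M.

Definition asdim_le (n : nat) :=
  forall D : R, 0 < D -> exists F : 'I_n.+1 -> set (set X),
    [/\ \bigcup_i \bigcup_(U in F i) U = [set: X],
        uniformly_bounded (\bigcup_i F i) &
        forall i, D_disjoint D (F i)].

(* +oo when no n satisfies `asdim_le n` *)
Definition asdim : \bar R := ereal_inf [set n%:R%:E | n in asdim_le].

End AsymptoticDimension.

Section HigsonCorona.
Context {R : realType} (X : metricType R).

Definition oscillation (f : X -> R) (r : R) (x : X) : \bar R :=
  ereal_sup [set `|f y - f x|%:E | y in [set y | mdist x y < r]].

Definition slowly_oscillating (f : X -> R) :=
  forall r : R, 0 < r -> forall e : R, 0 < e ->
    exists2 K : set X, compact K &
      forall x, ~ K x -> (oscillation f r x < e%:E)%E.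

Definition higson_functions : set (X -> R) :=
  [set f | [/\ bounded_fun f, continuous f & slowly_oscillating f]].

Definition higson_cube : topologicalType :=
  {ptws set_type higson_functions -> R}.

Definition higson_embedding : X -> higson_cube :=
  join_product (fun f : set_type higson_functions => set_val f).

(* The compactification corresponding to a family of bounded functions is the
   closure of the image of X under the evaluation map into the power of R
   indexed by the family. *)
Definition higson_compactification : set higson_cube :=
  closure (range higson_embedding).

Definition higson_corona : set higson_cube :=
  higson_compactification `\` range higson_embedding.

(* The closure may be taken in the ambient product, since the compactification
   is closed there. *)
Definition higson_trace (A : set X) : set (set_type higson_corona) :=
  set_val @^-1` closure (higson_embedding @` A).

End HigsonCorona.

Definition separator (Z : topologicalType) (C A B : set Z) :=
  closed C /\ exists U V : set Z,
    [/\ open U, open V, U `&` V = set0, ~` C = U `|` V & A `<=` U /\ B `<=` V].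

Section AsymptoticInductiveDimension.
Context {R : realType}.

(* The condition does not depend on the base point x0. *)
Definition asymptotically_disjoint (X : metricType R) (A B : set X) :=
  forall x0 : X,
    setdist (A `\` ball x0 r) (B `\` ball x0 r) @[r --> +oo%R] --> +oo%E.

Definition asymptotic_separator (X : metricType R) (C A B : set X) :=
  separator (higson_trace C) (higson_trace A) (higson_trace B).

(* `asInd_lt n X` stands for asInd X <= n - 1; the shift makes -1 the base
   case of a recursion on nat. *)
Fixpoint asInd_lt (n : nat) (X : metricType R) : Prop :=
  if n is m.+1 then
    forall A1 A2 : set X, asymptotically_disjoint A1 A2 ->
      exists C : set X,
        [/\ closed C, asymptotic_separator C A1 A2 & asInd_lt m (set_type C)]
  else metric_bounded [set: X].

(* +oo when no n satisfies `asInd_lt n X`. A bounded space has asInd = -1 but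
   asdim = 0, so the two dimensions can only agree on unbounded spaces. *)
Definition asInd (X : metricType R) : \bar R :=
  ereal_inf [set (n%:R - 1)%:E | n in [set n | asInd_lt n X]].

End AsymptoticInductiveDimension.

(* Main.v *)
Require Import Defs.
From mathcomp Require Import all_boot all_order all_algebra.
From mathcomp Require Import all_classical all_reals all_analysis.
From mathcomp Require Import ring lra.
From Stdlib Require Import Relation_Operators Operators_Properties.

Set Implicit Arguments.
Unset Strict Implicit.
Unset Printing Implicit Defensive.

Import Order.TTheory GRing.Theory Num.Theory.
Import numFieldNormedType.Exports.

Local Open Scope classical_set_scope.
Local Open Scope ring_scope.

(** Both dimensions are compared through colourings. Say that [X] has
    [asdim_lt n] if at every scale [D] it can be coloured, off a bounded set,
    with [n] colours so that monochromatic [D]-chains have uniformly bounded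
    ends; [asdim X <= n] is [asdim_lt n.+1 X] ([asdim_leP]). The theorem says
    that the least [n] with [asdim_lt n X] is the least [n] with
    [asInd_lt n X].

    The Higson corona is first traded for metric statements. Asymptotic
    disjointness of [A] and [B] means that [A] stays bounded near [B] ([far]),
    and it holds exactly when the traces of [A] and [B] are disjoint
    ([far_higson_trace]). Hence a decomposition of [X] into two pieces which
    are close to each other only close to [C] yields an asymptotic separator
    [C] ([asymptotic_separatorP]), and conversely a set far from a separator
    splits into two pieces far from each other
    ([asymptotic_separator_decomposition]).

    Lower bound ([asInd_lt_asdim_lt]): if [asInd_lt m X], [m <= k] and
    [asdim_lt k.+1 X], then [asdim_lt k X]. Otherwise, by compactness of
    colourings, there are annuli [F i], receding to infinity and away from each
    other, on which no [k]-colouring at a fixed scale respects a bound chosen in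
    advance. On [F i] take a colouring with [k.+1] colours at scale about [2i].
    For each of the first [k] colours [j], the points farther than [i] from
    colour [j] and the points of colour [j] form two sets [A j], [B j] that are
    far from each other. Iterated separation
    ([asInd_separation]) extends them to far sets [P j], [Q j], [j < k], which
    together cover [X] up to a bounded set. The distances to the [P j], cut off
    at a large constant, behave like coordinates on a cube of which every point
    has been pushed into the boundary, so that at every point one of the
    [k.+1] barycentric coordinates derived from them vanishes. A gap between
    these coordinates then defines a colouring with [k] colours and the same
    control as the given one ([colouring_of_witnesses]), a contradiction.

    Upper bound ([asdim_lt_asInd_lt]): if [asdim_lt n.+1 X] and [A], [B] are
    far, a separator [C] with [asdim_lt n C] is needed. Fix colourings with
    [n.+1] colours at rapidly growing scales [rho k], and let the zone of
    index [k] be its colour [0] outside a large ball. Two points of zones are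
    linked when they lie within the scale [rho k], with [k] the smaller of
    their levels, the level being the largest index of a zone around the
    point. The scales grow so fast that the classes of linked points stay
    bounded ([reach_dist]). Let [P] be the union of the classes that meet a
    neighbourhood of [A]. A pair of close points in [P] and its complement has
    a member outside all the zones of large index. The set [C] is made of nets
    of these complements of zones, chosen so sparse that at the scale [rho j]
    only the first [j] nets matter; those avoid the colour [0] of scale [rho j],
    so [n] colours suffice ([asdim_lt_skeleton]). *)

(** * Bounded and far-apart subsets of a metric space *)
Section Coarse.
Context {R : realType} {X : metricType R}.
Implicit Types A B C : set X.

Lemma mboundedS A B : A `<=` B -> metric_bounded B -> metric_bounded A.
Proof. by move=> AB [M hM]; exists M => x y /AB Bx /AB By; exact: hM. Qed.

Lemma mbounded_nbhd (r : R) A B : metric_bounded B ->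
  (forall a, A a -> exists2 b, B b & mdist a b <= r) -> metric_bounded A.
Proof.
move=> [M hM] AB; exists (r + M + r) => x y /AB[b Bb xb] /AB[c Bc yc].
have := metric_triangle x b y; have := metric_triangle b c y.
have := hM _ _ Bb Bc; rewrite (metric_sym c y); lra.
Qed.

Lemma mbounded0 : metric_bounded (set0 : set X).
Proof. by exists 0. Qed.

Lemma mbounded_ballP A (x0 : X) :
  metric_bounded A <-> exists r, forall a, A a -> mdist x0 a < r.
Proof.
split=> [[M hM]|[r hr]]; last first.
  exists (r + r) => x y /hr xr /hr yr.
  have := metric_triangle x x0 y; rewrite (metric_sym x x0); lra.
have [[a Aa]|nA] := pselect (exists a, A a); last first.
  by exists 0 => a Aa; case: nA; exists a.
exists (mdist x0 a + M + 1) => b Ab.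
have := hM _ _ Aa Ab; have := metric_triangle x0 a b; lra.
Qed.

Lemma mboundedU A B :
  metric_bounded A -> metric_bounded B -> metric_bounded (A `|` B).
Proof.
have [[x0 _]|nX] := pselect (exists x : X, True); last first.
  by move=> _ _; exists 0 => x; case: nX; exists x.
move=> /(mbounded_ballP _ x0)[r hr] /(mbounded_ballP _ x0)[s hs].
apply/(mbounded_ballP _ x0); exists (Num.max r s) => a [/hr|/hs] h;
  by rewrite lt_max h ?orbT.
Qed.

Lemma mbounded_bigcup (n : nat) (F : nat -> set X) :
  (forall j, (j < n)%N -> metric_bounded (F j)) ->
  metric_bounded [set x | exists2 j, (j < n)%N & F j x].
Proof.
elim: n => [_|n IH h]; first by exists 0 => x y [].
have : metric_bounded ([set x | exists2 j, (j < n)%N & F j x] `|` F n).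
  by apply: mboundedU; [apply: IH => j jn; apply/h/ltnW | exact: h].
apply: mboundedS => x [j]; rewrite ltnS leq_eqVlt => /orP[/eqP->|jn] Fx.
  by right.
by left; exists j.
Qed.

(** Asymptotic disjointness without a base point: for each [M], the part of
    [A] within [M] of [B] is bounded. See [far_asymptotically_disjoint]. *)
Definition far A B := forall M : R,
  metric_bounded [set a | A a /\ exists2 b, B b & mdist a b < M].

Lemma farC A B : far A B -> far B A.
Proof.
move=> h M; apply: (@mbounded_nbhd M _ _ (h M)) => b [Bb [a Aa ba]].
exists a; last exact: ltW.
by split=> //; exists b => //; rewrite metric_sym.
Qed.

Lemma farS A B A' B' : A' `<=` A -> B' `<=` B -> far A B -> far A' B'.
Proof.
move=> AA BB h M; apply: mboundedS (h M) => a [/AA Aa [b /BB Bb ab]].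
by split=> //; exists b.
Qed.

Lemma far_setUl A A' B : far A B -> far A' B -> far (A `|` A') B.
Proof.
move=> h h' M; apply: mboundedS (mboundedU (h M) (h' M)).
by move=> a [[Aa|Aa] hb]; [left|right].
Qed.

Lemma far_setUr A B B' : far A B -> far A B' -> far A (B `|` B').
Proof. by move=> /farC h /farC h'; apply/farC/far_setUl. Qed.

Lemma far0 A : far set0 A.
Proof. by move=> M; apply: mboundedS mbounded0 => a []. Qed.

Lemma far_meet A B : far A B -> metric_bounded (A `&` B).
Proof.
move=> /(_ 1); apply: mboundedS => a [Aa Ba]; split=> //; exists a => //.
by rewrite mdistxx.
Qed.

(** A neighbourhood of [A] that grows linearly with the distance to [B]. It
    makes far pairs of sets behave like disjoint closed sets in a normal
    space. *)
Definition closer A B : set X :=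
  [set x | exists2 a, A a & forall b, B b -> 3 * mdist x a <= mdist x b].

Lemma sub_closer A B : A `<=` closer A B.
Proof. by move=> a Aa; exists a => // b _; rewrite mdistxx mulr0 mdist_ge0. Qed.

(** If [x] and [y] are at distance less than [M], with nearby points [a] of [A]
    and [b] of [B], the factor [3] gives [mdist x a + mdist y b <= M], so [a]
    and [b] are within [2 * M]. *)
Lemma far_closer A B : far A B -> far (closer A B) (closer B A).
Proof.
move=> h M; apply: (@mbounded_nbhd M _ _ (h (2 * M + 1))).
move=> x [[a Aa xa] [y [b Bb yb] xy]].
have := xa _ Bb; have := yb _ Aa; have := metric_triangle x y b.
have := metric_triangle y x a; have := metric_triangle a x b.
have := metric_triangle x b y.
rewrite (metric_sym y x) (metric_sym a x) (metric_sym b y).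
have := mdist_ge0 x a; have := mdist_ge0 y b.
move=> *; exists a; last lra.
by split=> //; exists b => //; lra.
Qed.

Lemma far_closerC A B : far A B -> far A (~` closer A B).
Proof.
move=> h M; apply: mboundedS (h (4 * M)) => a [Aa [x nx ax]]; split=> //.
have /existsNP[b /not_implyP[Bb /negP]] : ~ forall b, B b -> 3 * mdist x a <= mdist x b.
  by move=> hx; apply: nx; exists a.
rewrite -ltNge => bx; exists b => //.
have := metric_triangle a x b; rewrite (metric_sym a x) in ax *; lra.
Qed.

Lemma far_asymptotically_disjoint A B :
  far A B <-> asymptotically_disjoint A B.
Proof.
split=> [h x0|h M].
  apply/cvgeyPge => M.
  have /(mbounded_ballP _ x0)[r hr] := h M.
  near=> s; apply: le_ereal_inf_tmp => _ /= [a [Aa sa] [b [Bb sb] <-]].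
  rewrite lee_fin leNgt; apply/negP => abM.
  have : mdist x0 a < r by apply: hr; split=> //; exists b.
  apply/negP; rewrite -leNgt.
  have : ~ mdist x0 a < s by move: sa; rewrite ballEmdist.
  move/negP; rewrite -leNgt; apply: le_trans.
  by near: s; apply: nbhs_pinfty_ge; exact: num_real.
have [[x0 _]|nX] := pselect (exists x : X, True); last first.
  by exists 0 => x; case: nX; exists x.
apply/(mbounded_ballP _ x0).
have /cvgeyPge/(_ M)[r [_ hr]] := h x0.
exists (r + `|M| + 2) => a [Aa [b Bb ab]]; rewrite ltNge; apply/negP => rx.
have := hr (r + 1); rewrite ltrDl => /(_ ltr01) /=.
apply/negP; rewrite -ltNge; apply: (@le_lt_trans _ _ (mdist a b)%:E).
  apply: ereal_inf_lbound; exists a; last exists b => //; split=> //;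
   rewrite ballEmdist /=; apply/negP; rewrite -leNgt.
    by have := normr_ge0 M; lra.
  have := metric_triangle x0 b a; rewrite (metric_sym b a).
  by have := ler_norm M; lra.
by rewrite lte_fin.
Unshelve. all: by end_near.
Qed.

End Coarse.

(** * Higson functions *)
Section HigsonFunctions.
Context {R : realType} {X : metricType R} (X_proper : proper_metric X).
Implicit Types A B C : set X.

Lemma compact_mbounded (K : set X) : compact K -> metric_bounded K.
Proof.
have [[x0 _]|nX] := pselect (exists x : X, True); last first.
  by move=> _; exists 0 => x; case: nX; exists x.
move=> /compact_near_coveringP /(_ R (+oo : set_system R)
  (fun r x => mdist x0 x < r) _).
case=> [x _|r [_ hr]].
  exists (ball x 1, [set r | mdist x0 x + 1 < r]) => /=.
    split; first exact: nbhsx_ballx.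
    by apply: nbhs_pinfty_gt; exact: num_real.
  move=> [y r] [/= xy xr]; rewrite ballEmdist /= in xy.
  have := metric_triangle x0 x y; lra.
apply/(mbounded_ballP _ x0); exists (r + 1) => a Ka.
by apply: (hr (r + 1)) => //; rewrite ltrDl.
Qed.

Lemma mbounded_compact A : metric_bounded A ->
  exists2 K : set X, compact K & A `<=` K.
Proof.
have [[x0 _]|nX] := pselect (exists x : X, True); last first.
  by move=> _; exists set0; [exact: compact0|move=> x; case: nX; exists x].
move=> /(mbounded_ballP _ x0)[r hr]; exists [set y | mdist x0 y <= r] => //.
by move=> x /hr /ltW.
Qed.

Lemma lipschitz_continuous (f : X -> R) (L : R) :
  (forall x y, `|f x - f y| <= L * mdist x y) -> continuous f.
Proof.
move=> fL x; apply/cvgrPdist_lt => e e0.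
near=> y; apply: le_lt_trans (fL x y) _.
have L0 : 0 < `|L| + 1 by have := normr_ge0 L; lra.
have : mdist x y < e / (`|L| + 1).
  near: y; apply/nbhs_ballP; exists (e / (`|L| + 1)) => /=.
    by rewrite divr_gt0.
  by move=> y; rewrite ballEmdist.
rewrite ltr_pdivlMr// => h.
apply: le_lt_trans h; rewrite mulrC ler_wpM2l ?mdist_ge0//.
have := ler_norm L; lra.
Unshelve. all: by end_near.
Qed.

Lemma higson_function (f : X -> R) (L : R) :
  (forall x, 0 <= f x <= 1) ->
  (forall x y, `|f x - f y| <= L * mdist x y) ->
  (forall r e : R, 0 < r -> 0 < e -> metric_bounded
     [set x | exists2 y, mdist x y < r & e <= `|f y - f x|]) ->
  higson_functions f.
Proof.
move=> f01 fL fosc; split.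
- exists 1; split; first exact: num_real.
  move=> M M1 x _ /=; have /andP[f0 f1] := f01 x.
  by rewrite ger0_norm// (le_trans f1)// ltW.
- exact: lipschitz_continuous fL.
- move=> r r0 e e0; have e20 : 0 < e / 2 by rewrite divr_gt0.
  have [K Kc hK] := mbounded_compact (fosc _ _ r0 e20).
  exists K => // x nKx; apply: (@le_lt_trans _ _ (e / 2)%:E); last first.
    by rewrite lte_fin; lra.
  apply: ge_ereal_sup => _ [y xy <-]; rewrite lee_fin leNgt; apply/negP => ey.
  by apply/nKx/hK; exists y => //; exact: ltW.
Qed.

(** Slow oscillation, with compact sets replaced by bounded ones. *)
Lemma higson_function_osc (f : X -> R) : higson_functions f ->
  forall r e : R, 0 < r -> 0 < e -> metric_bounded
     [set x | exists2 y, mdist x y < r & e <= `|f y - f x|].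
Proof.
move=> [_ _ fosc] r e r0 e0; have [K Kc hK] := fosc _ r0 _ e0.
apply: mboundedS (compact_mbounded Kc) => x [y xy].
apply: contraPP => /hK h; apply/negP; rewrite -ltNge -lte_fin.
apply: le_lt_trans h; by apply: ereal_sup_ubound; exists y.
Qed.

Definition tent (x y : X) : R := Num.max 0 (1 - mdist x y).

Lemma tent_higson x : higson_functions (tent x).
Proof.
have bL y z : tent x y - tent x z <= mdist y z.
  rewrite /tent; have := metric_triangle x y z; have := mdist_ge0 y z.
  by case: (leP 0 (1 - mdist x y)) => ?; case: (leP 0 (1 - mdist x z)) => ?; lra.
apply: (@higson_function _ 1).
- move=> y; rewrite /tent le_max lexx /= ge_max ler01 /=.
  by have := mdist_ge0 x y; lra.
- move=> y z; rewrite mul1r ler_norml; have := bL y z; have := bL z y.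
  rewrite (metric_sym z y); lra.
- move=> r e r0 e0; apply/(mbounded_ballP _ x); exists (r + 1).
  move=> y [z yz]; apply: contraTT; rewrite -leNgt -ltNge => ry.
  have h : tent x y = 0 by apply/max_idPl; lra.
  have -> : tent x z = 0.
    apply/max_idPl; have := metric_triangle x z y; rewrite (metric_sym z y).
    lra.
  by rewrite h subrr normr0.
Qed.

(** Used for nonempty [A] only; for empty [A] the infimum has the default
    value [0]. *)
Definition dset A (x : X) : R := inf [set mdist x a | a in A].

Lemma dset_ge0 A x : A !=set0 -> 0 <= dset A x.
Proof.
move=> [a Aa]; apply: lb_le_inf; first by exists (mdist x a); exists a.
by move=> _ [b _ <-]; exact: mdist_ge0.
Qed.

Lemma dset_le A x a : A a -> dset A x <= mdist x a.
Proof.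
move=> Aa; apply: ge_inf; last by exists a.
by exists 0 => _ [b _ <-]; exact: mdist_ge0.
Qed.

Lemma dset0 A a : A a -> dset A a = 0.
Proof.
move=> Aa; apply/eqP; rewrite eq_le dset_ge0 ?andbT; last by exists a.
by rewrite -(mdistxx a) dset_le.
Qed.

Lemma dset_lt A x r : A !=set0 -> dset A x < r -> exists2 a, A a & mdist x a < r.
Proof.
move=> [a0 Aa0] h.
have [|_ [a Aa <-] xa] := @inf_lt _ [set mdist x a | a in A] r _ h.
  by exists (mdist x a0); exists a0.
by exists a.
Qed.

Lemma dset_lip A x y : A !=set0 -> dset A x - dset A y <= mdist x y.
Proof.
move=> A0; rewrite lerBlDr; apply/ler_addgt0Pl => e e0.
have [|a Aa ya] := @dset_lt A y (dset A y + e) A0; first lra.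
have := dset_le x Aa; have := metric_triangle x y a; lra.
Qed.

(** The Lipschitz estimate for a Urysohn quotient: it improves as the
    denominator [a' + b' + 1] grows, which makes the function below slowly
    oscillating. *)
Lemma urysohn_ratio_lip (a b a' b' d : R) :
  0 <= a -> 0 <= b -> 0 <= a' -> 0 <= b' ->
  `|a - a'| <= d -> `|b - b'| <= d ->
  `|a / (a + b + 1) - a' / (a' + b' + 1)| * (a' + b' + 1) <= 3 * d.
Proof.
move=> a0 b0 a'0 b'0 ad bd.
have s0 : 0 < a + b + 1 by lra.
have s'0 : 0 < a' + b' + 1 by lra.
have -> : a / (a + b + 1) - a' / (a' + b' + 1) =
  (a * (a' + b' + 1) - a' * (a + b + 1)) / (a + b + 1) / (a' + b' + 1).
  by field; rewrite !gt_eqF.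
rewrite normrM normfV (gtr0_norm s'0) divfK ?gt_eqF//.
rewrite normrM normfV (gtr0_norm s0) ler_pdivrMr//.
have -> : a * (a' + b' + 1) - a' * (a + b + 1) =
  (a - a') * (b + 1) + a * (b' - b) by ring.
rewrite (le_trans (ler_normD _ _))// !normrM (distrC b') (ger0_norm a0).
rewrite (ger0_norm (_ : 0 <= b + 1)); last lra.
have d0 : 0 <= d by apply: le_trans ad.
have h1 : `|a - a'| * (b + 1) <= d * (b + 1) by rewrite ler_wpM2r//; lra.
have h2 : a * `|b - b'| <= a * d by rewrite ler_wpM2l.
nra.
Qed.

(** The quotient [dset A x / (dset A x + dset B x + 1)]: a point with bounded
    denominator is close to both [A] and [B], so the denominator tends to
    infinity. The summand [1] avoids a division by zero where [A] and [B]
    meet, at the price of the value [1 / 2] instead of [1] on [B]. *)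
Lemma far_higson_function A B : A !=set0 -> B !=set0 -> far A B ->
  exists f : X -> R, [/\ higson_functions f, forall a, A a -> f a = 0 &
    exists2 E, metric_bounded E & forall b, B b -> ~ E b -> 1 / 2 <= f b].
Proof.
move=> A0 B0 AB; pose s x := dset A x + dset B x + 1.
pose f x := dset A x / s x.
have s1 x : 1 <= s x.
  by rewrite /s; have := dset_ge0 x A0; have := dset_ge0 x B0; lra.
have fL x y : `|f x - f y| * s y <= 3 * mdist x y.
  apply: urysohn_ratio_lip; rewrite ?dset_ge0// ler_norml.
    have := dset_lip x y A0; have := dset_lip y x A0.
    by rewrite (metric_sym y x); lra.
  have := dset_lip x y B0; have := dset_lip y x B0.
  by rewrite (metric_sym y x); lra.
exists f; split.
- apply: (@higson_function _ 3).
  + move=> x; have s0 : 0 < s x by have := s1 x; lra.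
    rewrite divr_ge0 ?dset_ge0 ?(ltW s0)//= ler_pdivrMr// mul1r /s.
    by have := dset_ge0 x B0; lra.
  + move=> x y; apply: le_trans (fL x y).
    by rewrite ler_peMr.
  + move=> r e r0 e0.
    apply: (@mbounded_nbhd _ _ (3 * r / e + 1) _ _ (AB (2 * (3 * r / e + 1)))).
    move=> x [y xy ey].
    have h : e * s x <= 3 * mdist x y.
      rewrite (metric_sym x y); apply: le_trans (fL y x).
      by rewrite ler_wpM2r//; have := s1 x; lra.
    have {h}h : s x <= 3 * r / e.
      by rewrite ler_pdivlMr// mulrC (le_trans h)//; lra.
    have [|a Aa xa] := @dset_lt A x (3 * r / e + 1) A0.
      by move: h; rewrite /s; have := dset_ge0 x B0; lra.
    have [|b Bb xb] := @dset_lt B x (3 * r / e + 1) B0.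
      by move: h; rewrite /s; have := dset_ge0 x A0; lra.
    exists a; last exact: ltW.
    split=> //; exists b => //.
    by have := metric_triangle a x b; rewrite (metric_sym a x); lra.
- by move=> a Aa; rewrite /f dset0// mul0r.
- exists [set b | B b /\ exists2 a, A a & mdist b a < 2].
    exact: farC AB 2.
  move=> b Bb nE.
  have h : 1 <= dset A b.
    rewrite leNgt; apply/negP => h; apply: nE; split=> //.
    by apply: dset_lt => //; lra.
  rewrite /f /s (dset0 Bb) addr0 ler_pdivlMr; lra.
Qed.

End HigsonFunctions.

(** * Asymptotic disjointness in the Higson corona *)
Section Corona.
Context {R : realType} {X : metricType R} (X_proper : proper_metric X).
Implicit Types A B C : set X.

Local Notation H := (set_type (@higson_functions R X)).
Local Notation e := (@higson_embedding R X).
Local Notation cube := (higson_cube X).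

Definition higson_coord (f : H) (z : cube) : R := (z : H -> R) f.

Lemma higson_coord_continuous f : continuous (higson_coord f).
Proof. exact: (@proj_continuous _ (fun _ : H => R) f). Qed.

Lemma higson_embedding_continuous : continuous e.
Proof.
move=> x; apply/cvg_sup => f; move: x.
apply/(@continuousP _ (initial_topology (@^~ f))) => A [B oB <-].
have -> : e @^-1` ((@^~ f) @^-1` B) = set_val f @^-1` B by [].
apply: open_comp => // y _; have [] := set_valP f => _ + _; exact.
Qed.

Lemma higson_cube_hausdorff : hausdorff_space cube.
Proof. by apply: (@hausdorff_product _ (fun _ : H => R)) => _; exact: Rhausdorff. Qed.

Lemma higson_cube_regular : regular_space cube.
Proof. exact: (@uniform_regular ({ptws H -> R} : uniformType)). Qed.

(** A bounded set lies in a compact one, whose image is compact, hence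
    closed. *)
Lemma closure_higson_bounded A z :
  metric_bounded A -> closure (e @` A) z -> range e z.
Proof.
move=> /(mbounded_compact X_proper)[K Kc AK] zA.
have eK : closed (e @` K).
  apply: compact_closed; first exact: higson_cube_hausdorff.
  by apply: continuous_compact => //; apply/continuous_subspaceT/higson_embedding_continuous.
have : closure (e @` K) z by apply: closureS zA; exact: image_subset.
by rewrite -(closure_id _).1// => -[x _ <-]; exists x.
Qed.

Definition higson_index (f : X -> R) (hf : higson_functions f) : H := exist _ f (mem_set hf).

Lemma higson_coord_embedding f (hf : higson_functions f) x :
  higson_coord (higson_index hf) (e x) = f x.
Proof. by []. Qed.

Lemma closure_higson_coord (f : H) A z (D : set R) : closed D ->
  (forall x, A x -> D (higson_coord f (e x))) -> closure (e @` A) z -> D (higson_coord f z).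
Proof.
move=> cD h zA; have cf : closed (higson_coord f @^-1` D).
  by apply: preimage_closed => // y _; exact: higson_coord_continuous.
have : closure (higson_coord f @^-1` D) z.
  by apply: closureS zA => _ [x Ax <-]; exact: h.
by rewrite -(closure_id _).1.
Qed.

(** The separating function of [far_higson_function] extends to the closure,
    where it would be both [0] and at least [1 / 2]. *)
Lemma far_closure_inter A B z : far A B ->
  closure (e @` A) z -> closure (e @` B) z -> range e z.
Proof.
move=> AB zA zB.
have ne C : closure (e @` C) z -> C !=set0.
  by move=> /(_ setT filterT)[_ [[x Cx _] _]]; exists x.
have [f [hf fA [E Eb fB]]] := far_higson_function X_proper (ne _ zA) (ne _ zB) AB.
have /= z0 : [set 0] (higson_coord (higson_index hf) z).
  by apply: closure_higson_coord zA; [exact: closed_eq|move=> x /fA].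
have : closure (e @` (B `&` E) `|` e @` (B `\` E)) z.
  rewrite -image_setU; apply: closureS zB; apply: image_subset => x Bx.
  by have [Ex|nEx] := pselect (E x); [left|right].
rewrite closureU => -[|zBE].
  by apply: closure_higson_bounded; apply: mboundedS Eb => x [].
have /= : [set t : R | 1 / 2 <= t] (higson_coord (higson_index hf) z).
  by apply: closure_higson_coord zBE; [exact: closed_ge|move=> x [Bx nEx]; exact: fB].
by rewrite z0; lra.
Qed.

(** Tested on the tent function at [x], which vanishes along the sequence far
    away from [x] but not at [x]. *)
Lemma unbounded_trace_notin (u : nat -> X) (x0 : X) z :
  (forall n, n%:R <= mdist x0 (u n)) ->
  (forall N, closure (e @` [set u n | n in [set n | (N <= n)%N]]) z) -> ~ range e z.
Proof.
move=> hu zu [x _ xz].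
have [N hN] : exists N : nat, mdist x0 x + 1 < N%:R.
  exists (Num.truncn (mdist x0 x + 1)).+1; exact: truncnS_gt.
have /= : [set 0] (higson_coord (higson_index (tent_higson X_proper x)) z).
  apply: closure_higson_coord (zu N); first exact: closed_eq.
  move=> _ [n /= Nn <-]; rewrite higson_coord_embedding; apply/max_idPl.
  have := metric_triangle x0 x (u n); have := hu n.
  have : N%:R <= n%:R :> R by rewrite ler_nat.
  lra.
rewrite -xz higson_coord_embedding /tent mdistxx subr0 => /eqP.
by rewrite maxEle ler01 oner_eq0.
Qed.

Lemma compactification_compact : compact (@higson_compactification R X).
Proof.
have /choice[bnd hbnd] : forall f : H, exists c : R, forall x, `|set_val f x| <= c.
  move=> f; have [[c [_ hc]] _ _] := set_valP f.
  exists (c + 1) => x; have := hc (c + 1); rewrite ltrDl ltr01 => /(_ isT x).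
  by apply.
pose I (f : H) : set R := `[- bnd f, bnd f]%classic.
pose K : set cube := [set z | forall f : H, I f (higson_coord f z)].
have Kc : compact K.
  by apply: (@tychonoff _ (fun _ : H => R) I) => f; exact: segment_compact.
have KX x : K (e x) by move=> f; rewrite /I /= in_itv /= -ler_norml; exact: hbnd.
apply: (subclosed_compact _ Kc); first exact: closed_closure.
rewrite [K in _ `<=` K](closure_id _).1; last exact: compact_closed higson_cube_hausdorff Kc.
by apply: closureS => _ [x _ <-].
Qed.

(** Tent functions show that [X] is open in its compactification. *)
Lemma closed_corona : closed (@higson_corona R X).
Proof.
move=> z zc; split.
  by apply: closed_closure; apply: closureS zc => w [].
move=> [x _ xz]; pose t := higson_index (tent_higson X_proper x).
have nz : nbhs z [set w | `|higson_coord t z - higson_coord t w| < 1].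
  by have /cvgrPdist_lt := @higson_coord_continuous t z; exact.
have [w [[wX nw] /= hw]] := zc _ nz.
have : closure (e @` [set y | mdist x y < 1] `|` e @` [set y | ~ mdist x y < 1]) w.
  rewrite -image_setU; apply: closureS wX; apply: image_subset => y _.
  by have [?|?] := pselect (mdist x y < 1); [left|right].
rewrite closureU => -[|w0].
  move=> h; apply: nw; apply: closure_higson_bounded h.
  by apply/(mbounded_ballP _ x); exists 1.
have /= tw : [set 0] (higson_coord t w).
  apply: closure_higson_coord w0; first exact: closed_eq.
  move=> y /negP; rewrite -leNgt => xy; rewrite higson_coord_embedding; apply/max_idPl; lra.
move: hw; rewrite tw -xz higson_coord_embedding /tent mdistxx subr0 subr0 max_r ?ler01//.
by rewrite normr1 ltxx.
Qed.

(** Pairs of points of [A] and [B] at bounded distance can be chosen to go to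
    infinity. By compactness their images accumulate at some [(z, z')], and
    [z = z'] because Higson functions oscillate slowly. *)
Lemma not_far_closure_inter A B : ~ far A B ->
  exists z, [/\ closure (e @` A) z, closure (e @` B) z & ~ range e z].
Proof.
move=> /existsNP[M nM].
have [x0 _] : exists x : X, True.
  apply: contrapT => nX; apply: nM; exists 0 => x; case: nX; by exists x.
have {nM}/choice[u hu] : forall n : nat, exists ab : X * X,
    [/\ A ab.1, B ab.2, mdist ab.1 ab.2 < M & n%:R <= mdist x0 ab.1].
  move=> n; apply: contrapT => nab; apply: nM; apply/(mbounded_ballP _ x0).
  exists n%:R => a [Aa [b Bb ab]]; rewrite ltNge; apply/negP => na.
  by apply: nab; exists (a, b).
have KX x : higson_compactification (e x) by apply: subset_closure; exists x.
have := compact_setX compactification_compact compactification_compact.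
pose w n := (e (u n).1, e (u n).2).
move=> /(_ (w @ \oo) _)[|[z z'] [_ clw]].
  by exists 0%N => // n _; split; exact: KX.
(* Arbitrarily late pairs come close to the cluster point. *)
have inv N V V' : nbhs z V -> nbhs z' V' ->
    exists n, [/\ (N <= n)%N, V (e (u n).1) & V' (e (u n).2)].
  move=> zV zV'; have [||p [[n Nn <-] [/= h1 h2]]] :=
    clw [set w n | n in [set n | (N <= n)%N]] (V `*` V').
  - by exists N => // n Nn; exists n.
  - by exists (V, V').
  by exists n.
have zz' : z = z'.
  apply: funext => f; apply/eqP; rewrite -subr_eq0 -normr_le0.
  apply/ler_addgt0Pl => eps eps0; rewrite addr0.
  have e30 : 0 < eps / 3 by rewrite divr_gt0.
  have /(mbounded_ballP _ x0)[r hr] :=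
    higson_function_osc (set_valP f) (ltr_pwDr ltr01 (normr_ge0 M)) e30.
  have nb y : nbhs y [set y' | `|higson_coord f y - higson_coord f y'| < eps / 3].
    have /cvgrPdist_lt := @higson_coord_continuous f y; exact.
  have [n [Nn h1 h2]] := inv (Num.truncn r).+1 _ _ (nb z) (nb z').
  have [_ _ abM nle] := hu n.
  have h3 : `|higson_coord f (e (u n).1) - higson_coord f (e (u n).2)| < eps / 3.
    rewrite ltNge; apply/negP => h3.
    have := hr (u n).1; apply/not_implyP; split.
      exists (u n).2; first by have := ler_norm M; lra.
      by rewrite distrC.
    apply/negP; rewrite -leNgt; apply: le_trans nle.
    apply: (@le_trans _ _ (Num.truncn r).+1%:R); last by rewrite ler_nat.
    exact/ltW/truncnS_gt.
  rewrite -/(higson_coord f z) -/(higson_coord f z').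
  have -> : higson_coord f z - higson_coord f z' = (higson_coord f z - higson_coord f (e (u n).1)) +
     (higson_coord f (e (u n).1) - higson_coord f (e (u n).2)) - (higson_coord f z' - higson_coord f (e (u n).2)) by ring.
  apply: (le_trans (ler_normB _ _)).
  have := ler_normD (higson_coord f z - higson_coord f (e (u n).1)) (higson_coord f (e (u n).1) - higson_coord f (e (u n).2)).
  move: h1 h2 => /=; lra.
subst z'; exists z; split.
- move=> V zV; have [n [_ h _]] := inv 0%N _ _ zV filterT.
  by exists (e (u n).1); split=> //; exists (u n).1 => //; have [] := hu n.
- move=> V zV; have [n [_ _ h]] := inv 0%N _ _ filterT zV.
  by exists (e (u n).2); split=> //; exists (u n).2 => //; have [] := hu n.
- apply: (@unbounded_trace_notin (fun n => (u n).1) x0) => [n|N V zV].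
    by have [] := hu n.
  have [n [Nn h _]] := inv N _ _ zV filterT.
  by exists (e (u n).1); split=> //; exists (u n).1 => //; exists n.
Qed.

End Corona.

(** * Asymptotic separators in metric terms *)
Section Separators.
Context {R : realType} {X : metricType R} (X_proper : proper_metric X).
Implicit Types A B C D P Q : set X.

Local Notation e := (@higson_embedding R X).
Local Notation cube := (higson_cube X).

Lemma closed_trace A : closed (higson_trace A).
Proof.
apply: preimage_closed; last exact: closed_closure.
by move=> z _; exact: initial_continuous.
Qed.

Lemma corona_lift z A : closure (e @` A) z -> ~ range e z ->
  exists zz : set_type (@higson_corona R X), set_val zz = z.
Proof.
move=> zA nz; have h : higson_corona z.
  by split=> //; apply: closureS zA => _ [x _ <-]; exists x.
by exists (exist _ z (mem_set h)).
Qed.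

Lemma far_higson_trace A B :
  far A B <-> higson_trace A `&` higson_trace B = set0.
Proof.
split=> [AB|AB].
  rewrite -subset0 => z [zA zB]; have [_ nz] := set_valP z.
  by apply: nz; exact: far_closure_inter AB zA zB.
apply: contrapT => /(not_far_closure_inter X_proper)[z [zA zB nz]].
have [zz zzE] := corona_lift zA nz.
suff : (higson_trace A `&` higson_trace B) zz by rewrite AB.
by split; rewrite /higson_trace /= zzE.
Qed.

(** A common point of the traces of [P] and [Q] lies in the trace of [C]:
    if not, intersect [P] and [Q] with a small neighbourhood of that point
    whose closure misses the closure of [C]. The pieces are still not far from
    each other, so by the last hypothesis the piece of [P] is not far from [C]
    and their closures meet at infinity, a contradiction. The complements
    of the traces of [Q] and [P] in the complement of the trace of [C] are then
    the two sides. *)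
Lemma asymptotic_separatorP A B C P Q :
  P `|` Q = setT -> far A Q -> far A C -> far B P -> far B C ->
  (forall r, exists r', metric_bounded [set p | [/\ P p,
     exists2 q, Q q & mdist p q < r & ~ exists2 c, C c & mdist p c < r']]) ->
  asymptotic_separator C A B.
Proof.
move=> PQ AQ AC BP BC hC.
have PQC z : higson_trace P z -> higson_trace Q z -> higson_trace C z.
  move=> zP zQ; apply: contrapT => nzC.
  have oC : nbhs (set_val z) (~` closure (e @` C)).
    by apply: open_nbhs_nbhs; split=> //; exact/closed_openC/closed_closure.
  have [V zV VC] := higson_cube_regular oC.
  pose W := [set x | V (e x)].
  have cl S : higson_trace S z -> closure (e @` (S `&` W)) (set_val z).
    move=> zS U zU; have [_ [[x Sx <-] [Ux Vx]]] := zS _ (filterI zU zV).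
    by exists (e x); split=> //; exists x.
  have nPQ : ~ far (P `&` W) (Q `&` W).
    by move=> h; have [_] := set_valP z; apply; apply: far_closure_inter h (cl _ zP) (cl _ zQ).
  have nPC : ~ far (P `&` W) C.
    move=> h; apply: nPQ => r; have [r' hr'] := hC r.
    apply: mboundedS (mboundedU hr' (h r')) => p [[Pp Wp] [q [Qq _] pq]].
    have [hc|nc] := pselect (exists2 c, C c & mdist p c < r'); first by right.
    by left; split=> //; exists q.
  have [w [wP wC _]] := not_far_closure_inter X_proper nPC.
  apply: (VC w) wC; apply: closureS wP => _ [x [_ Wx] <-]; exact: Wx.
split; first exact: closed_trace.
have cov z : higson_trace P z \/ higson_trace Q z.
  have [zX _] := set_valP z; suff : (closure (e @` P) `|` closure (e @` Q)) (set_val z) by [].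
  by rewrite -closureU -image_setU PQ.
exists (~` (higson_trace Q `|` higson_trace C)), (~` (higson_trace P `|` higson_trace C)).
split.
- by apply: closed_openC; apply: closedU; exact: closed_trace.
- by apply: closed_openC; apply: closedU; exact: closed_trace.
- rewrite -subset0 => z [/not_orP[nQ _] /not_orP[nP _]].
  by case: (cov z).
- rewrite -setCI; congr (~` _); apply/seteqP; split=> z; first by move=> zC; split; right.
  by move=> [[zQ|//] [zP|//]]; exact: PQC.
- split=> z zA [zQ|zC].
  + by have /far_higson_trace/seteqP[/(_ z) h _] := AQ; exact: h.
  + by have /far_higson_trace/seteqP[/(_ z) h _] := AC; exact: h.
  + by have /far_higson_trace/seteqP[/(_ z) h _] := BP; exact: h.
  + by have /far_higson_trace/seteqP[/(_ z) h _] := BC; exact: h.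
Qed.

(** Otherwise the sets [K `\` N], for [N] open with closure in [O], generate
    a proper filter; a cluster point of it in [K] contradicts regularity. *)
Lemma compact_sub_open (K O : set cube) : compact K -> open O -> K `<=` O ->
  exists N : set cube, [/\ open N, K `<=` N & closure N `<=` O].
Proof.
move=> Kc Oo KO; apply: contrapT => nN.
pose good := [set N : set cube | open N /\ closure N `<=` O].
pose G := filter_from good (fun N => K `\` N).
have FG : ProperFilter G.
  apply: filter_from_proper.
    apply: filter_from_filter.
      by exists set0; split; [exact: open0|rewrite closure0].
    move=> N N' [No NO] [N'o N'O]; exists (N `|` N').
      by split; [exact: openU|rewrite closureU => z [/NO|/N'O]].
    by move=> z [Kz /not_orP[]].
  move=> N [No NO]; apply: contrapT => nz; apply: nN; exists N; split=> // z Kz.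
  by apply: contrapT => nNz; apply: nz; exists z.
have [|z [Kz Gz]] := Kc G FG.
  by exists set0; [split; [exact: open0|rewrite closure0]|move=> z []].
have zO : nbhs z O by apply: open_nbhs_nbhs; split=> //; exact: KO.
have [V zV VO] := higson_cube_regular zO.
suff GV : G (K `\` V°) by have [w [[_ nVw] Vw]] := Gz _ _ GV (nbhs_interior zV).
exists V° => //; split; first exact: open_interior.
by apply: subset_trans VO; apply: closureS; exact: interior_subset.
Qed.

(** The trace of [D] is a compact set disjoint from that of [C], so the two
    sides of the separator cut it into two compact parts. An open set [N]
    around one of them with closure inside the first side cuts [D]
    accordingly. *)
Lemma asymptotic_separator_decomposition A B C D :
  asymptotic_separator C A B -> far C D ->
  exists P Q, [/\ P `|` Q = D, far P Q, far P B & far Q A].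
Proof.
move=> [_ [_ [_ [[U oU <-] [V oV <-] UV0 CUV [AU BV]]]]] CD.
have UV z : higson_corona z -> U z -> V z -> False.
  move=> hz Uz Vz; have /seteqP[h _] := UV0.
  by apply: (h (exist _ z (mem_set hz))).
have DUV z : higson_corona z -> closure (e @` D) z -> U z \/ V z.
  move=> hz zD; pose zz : set_type (@higson_corona R X) := exist _ z (mem_set hz).
  have : (~` higson_trace C) zz.
    by move=> zC; have /far_higson_trace/seteqP[/(_ zz) h _] := CD; exact: h.
  by rewrite CUV.
pose K := (closure (e @` D) `&` @higson_corona R X) `\` V.
have Kc : compact K.
  apply: (subclosed_compact _ (@compactification_compact R X)); last by move=> z [[_ []]].
  apply: closedI; last exact: open_closedC.
  by apply: closedI; [exact: closed_closure|exact: closed_corona].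
have KU : K `<=` U by move=> z [[zD hz] nV]; case: (DUV z hz zD).
have [N [No KN NU]] := compact_sub_open Kc oU KU.
pose P := D `&` [set x | N (e x)]; pose Q := D `&` [set x | ~ N (e x)].
have trP z : closure (e @` P) z -> closure N z /\ closure (e @` D) z.
  move=> zP; split; apply: closureS zP; first by move=> _ [x [_ Nx] <-].
  by move=> _ [x [Dx _] <-]; exists x.
have trQ z : higson_corona z -> closure (e @` Q) z -> V z.
  move=> hz zQ; have zD : closure (e @` D) z by apply: closureS zQ => _ [x [Dx _] <-]; exists x.
  apply: contrapT => nV; have Nz : nbhs z N.
    by apply: open_nbhs_nbhs; split=> //; exact: KN.
  by have [_ [[x [_ nNx] <-] Nx]] := zQ _ Nz.
exists P, Q; split.
- apply/seteqP; split=> x; first by case=> -[].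
  by move=> Dx; have [?|?] := pselect (N (e x)); [left|right].
- apply/far_higson_trace; rewrite -subset0 => z [zP zQ].
  apply: (UV (set_val z)); [exact: set_valP|by apply: NU; case: (trP _ zP)|].
  by apply: trQ zQ; exact: set_valP.
- apply/far_higson_trace; rewrite -subset0 => z [zP zB].
  apply: (UV (set_val z)); [exact: set_valP|by apply: NU; case: (trP _ zP)|].
  exact: BV.
- apply/far_higson_trace; rewrite -subset0 => z [zQ zA].
  apply: (UV (set_val z)); [exact: set_valP|exact: AU|].
  by apply: trQ zQ; exact: set_valP.
Qed.

End Separators.

(** * Chains and colourings *)
Section Closures.
Context {T : Type}.
Implicit Types r : T -> T -> Prop.

Lemma clos_rt_inv r (I : T -> Prop) x y :
  (forall y z, r y z -> I y -> I z) -> clos_refl_trans T r x y -> I x -> I y.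
Proof.
move=> hI; elim=> [a b|a|a b c _ IH1 _ IH2]; first exact: hI.
  by [].
by move=> /IH1.
Qed.

Lemma clos_rt_mono r r' x y : (forall a b, r a b -> r' a b) ->
  clos_refl_trans T r x y -> clos_refl_trans T r' x y.
Proof.
move=> rr; elim=> [a b /rr ?|a|a b c _ IH1 _ IH2]; first exact: rt_step.
  exact: rt_refl.
exact: rt_trans IH1 IH2.
Qed.

Lemma clos_rt_sym r x y : (forall a b, r a b -> r b a) ->
  clos_refl_trans T r x y -> clos_refl_trans T r y x.
Proof.
move=> rr; elim=> [a b /rr ?|a|a b c _ IH1 _ IH2]; first exact: rt_step.
  exact: rt_refl.
exact: rt_trans IH2 IH1.
Qed.

End Closures.

Section Chains.
Context {R : realType} {X : metricType R}.
Implicit Types (D M : R) (S : set X).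

Definition link D S (x y : X) := [/\ S x, S y & mdist x y <= D].

Definition chain D S := clos_refl_trans X (link D S).

Lemma chain_sym D S x y : chain D S x y -> chain D S y x.
Proof.
by apply: clos_rt_sym => a b [Sa Sb ab]; split=> //; rewrite metric_sym.
Qed.

Lemma chainS D D' S S' x y :
  D <= D' -> S `<=` S' -> chain D S x y -> chain D' S' x y.
Proof.
move=> DD SS; apply: clos_rt_mono => a b [/SS Sa /SS Sb ab].
by split=> //; exact: le_trans DD.
Qed.

Lemma chain_end D S x y : chain D S x y -> x = y \/ S y.
Proof.
move=> h; apply: (clos_rt_inv (I := fun y => x = y \/ S y)) h _; last by left.
by move=> a b [_ Sb _] _; right.
Qed.

(** Colourings are total functions, of which only the values on [S] count;
    this makes restriction to smaller sets trivial. *)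
Definition colouring D M (n : nat) S (c : X -> nat) :=
  (forall x, S x -> (c x < n)%N) /\
  forall k x y, chain D [set z | S z /\ c z = k] x y -> mdist x y <= M.

Lemma colouringW D D' M M' n S S' c : D' <= D -> M <= M' -> S' `<=` S ->
  colouring D M n S c -> colouring D' M' n S' c.
Proof.
move=> DD MM SS [h1 h2]; split=> [x /SS/h1//|k x y h].
apply: le_trans MM; apply: (h2 k); apply: chainS h => // z [/SS]; by [].
Qed.

End Chains.

(** The bounded exceptional set [E] lets [asdim_lt 0] characterize bounded
    spaces, in line with [asInd_lt 0]. *)
Definition asdim_lt (R : realType) (n : nat) (X : metricType R) :=
  forall D : R, exists (M : R) (E : set X) (c : X -> nat),
    metric_bounded E /\ colouring D M n (~` E) c.

Section AsdimColouring.
Context {R : realType} {X : metricType R}.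

(** The bounded set [E] receives the colour [0]. A new chain of colour [0]
    either avoids [E] or has both ends within [M + D] of [E]. *)
Lemma colouring_absorb (D M : R) (n : nat) (E : set X) c : 0 <= D ->
  metric_bounded E -> colouring D M n.+1 (~` E) c ->
  exists M' c', colouring D M' n.+1 [set: X] c'.
Proof.
move=> D0 [B hB] [cn cM]; pose c' x := if `[< E x >] then 0%N else c x.
exists (`|M| + D + `|B| + D + `|M|), c'; split.
  by move=> x _; rewrite /c'; case: asboolP => // nE; exact: cn.
move=> k x y.
pose S := [set z | (~` E) z /\ c z = k].
pose I y := exists2 y0, chain D S y0 y & x = y0 \/
  exists e e', [/\ E e, E e', mdist x e <= `|M| + D & mdist e' y0 <= D].
have M0 : 0 <= `|M| by exact: normr_ge0.
have MM : M <= `|M| by exact: ler_norm.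
have BB : B <= `|B| by exact: ler_norm.
have B0 : 0 <= `|B| by exact: normr_ge0.
move=> xy; have [y0 y0y [xy0|[e [e' [Ee Ee' xe e'y0]]]]] : I y.
- apply: (clos_rt_inv (I := I)) xy _; last by exists x; [exact: rt_refl|left].
  move=> {}y z [[_ yk] [_ zk] yz] [y0 y0y hy0].
  have y0yM := cM _ _ _ y0y.
  have [Ez|nEz] := pselect (E z).
    exists z; first exact: rt_refl.
    right; case: hy0 => [xy0|[e [e' [Ee Ee' xe _]]]]; last first.
      by exists e, z; split=> //; rewrite mdistxx.
    exists z, z; split; rewrite ?mdistxx//.
    by subst y0; have := metric_triangle x y z; lra.
  have [Ey|nEy] := pselect (E y).
    exists z; first exact: rt_refl.
    right; case: hy0 => [xy0|[e [e' [Ee Ee' xe _]]]]; last by exists e, y.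
    by exists y, y; split=> //; subst y0; lra.
  exists y0 => //; apply: (rt_trans _ _ _ _ _ y0y); apply: rt_step.
  by split=> //; split=> //; [rewrite -yk|rewrite -zk]; rewrite /c' asboolF.
- by rewrite xy0; have := cM _ _ _ y0y; lra.
- have := cM _ _ _ y0y; have := hB _ _ Ee Ee'.
  have := metric_triangle x e y; have := metric_triangle e e' y.
  have := metric_triangle e' y0 y; lra.
Qed.

(** From a cover, colour a point by a family that covers it: chains of
    steps shorter than the separation stay in one member. Conversely, take the
    chain components of the colour classes as members. *)
Lemma asdim_leP (n : nat) : asdim_le X n <-> asdim_lt n.+1 X.
Proof.
split=> [h D|h D D0].
  have [|F [Fcov [M hM] FD]] := h (`|D| + 1); first by have := normr_ge0 D; lra.
  have /choice[c hc] : forall x, exists i : 'I_n.+1, exists2 U, F i U & U x.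
    move=> x; have : [set: X] x by [].
    by rewrite -Fcov => -[i _ [U FU Ux]]; exists i, U.
  exists (Num.max M 0), set0, (fun x => val (c x)); split; first exact: mbounded0.
  split=> [x _|k x y xy]; first exact: ltn_ord.
  have [U FU Ux] := hc x.
  have [|[_ ck]] := chain_end (chain_sym xy).
    by move=> ->; rewrite mdistxx le_max lexx orbT.
  suff Uy : U y.
    by rewrite le_max (hM U)//; exists (c x).
  apply: (clos_rt_inv (I := U)) xy Ux => a b [[_ ak] [_ bk] ab] Ua.
  have [V FV Vb] := hc b.
  have cE : c b = c x by apply: val_inj; rewrite /= bk.
  rewrite cE in FV; have [<-//|/eqP UV] := eqVneq V U.
  have : (setdist U V <= (mdist a b)%:E)%E.
    by apply: ereal_inf_lbound; exists a => //; exists b.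
  have := FD (c x) U V FU FV (nesym UV); move=> /le_trans/[apply].
  by rewrite lee_fin; have := ler_norm D; lra.
have [M0 [E [c0 [Eb col0]]]] := h D.
have [M [c [cn cM]]] := colouring_absorb (ltW D0) Eb col0.
pose cl i x := [set y | chain D [set z | [set: X] z /\ c z = i] x y].
exists (fun i : 'I_n.+1 => [set U | exists2 x, c x = val i & U = cl (val i) x]); split.
- apply/seteqP; split=> // x _; exists (Ordinal (cn x Logic.I)) => //.
  by exists (cl (c x) x); [exists x|exact: rt_refl].
- exists M => _ [i _ [x _ ->]] y z xy xz; apply: (cM (val i)).
  exact: rt_trans (chain_sym xy) xz.
- move=> i _ _ [x xi ->] [y yi ->] ne.
  apply: le_ereal_inf_tmp => _ [a xa [b yb <-]].
  rewrite lee_fin leNgt; apply/negP => ab; apply: ne.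
  have ai : c a = i by have [<-//|[]] := chain_end xa.
  have bi : c b = i by have [<-//|[]] := chain_end yb.
  have xy : cl (val i) x y.
    apply: rt_trans xa _; apply: rt_trans (chain_sym yb).
    by apply: rt_step; split=> //; exact: ltW.
  apply/seteqP; split=> z; first by apply: rt_trans; exact: chain_sym.
  by apply: rt_trans.
Qed.

End AsdimColouring.

(** * Iterated separation *)
Section Subspaces.
Context {R : realType} {X : metricType R}.
Implicit Types C : set X.

Lemma proper_subspace C : proper_metric X -> closed C ->
  proper_metric (set_type C).
Proof.
move=> X_proper Ccl x r; set K := [set y | _].
have KX : compact [set y | mdist (set_val x) y <= r] by exact: X_proper.
have /= KC := compact_closedI KX Ccl.
move=> F FF FK.
have [] := KC (set_val @ F) _.
  by apply: (@filterS _ F _ K) FK => y yK; split=> //; exact: set_valP.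
move=> p [[xp Cp] clp]; exists (exist _ p (mem_set Cp)); split=> // V W FV.
rewrite nbhsE => -[_ [[G oG <-] Gp] GW].
have [_ [[y Vy <-] Gy]] : (set_val @` V) `&` G !=set0.
  apply: clp; last exact: open_nbhs_nbhs.
  by apply: (@filterS _ F _ V) FV => y Vy; exists y.
by exists y; split=> //; exact: GW.
Qed.

Lemma mbounded_image C (P : set (set_type C)) :
  metric_bounded P -> metric_bounded (set_val @` P).
Proof. by move=> [M hM]; exists M => _ _ [x Px <-] [y Py <-]; exact: hM. Qed.

Lemma far_image C (P Q : set (set_type C)) :
  far P Q -> far (set_val @` P) (set_val @` Q).
Proof.
move=> h M; apply: mboundedS (mbounded_image (h M)).
by move=> _ [[p Pp <-] [_ [q Qq <-] pq]]; exists p => //; split=> //; exists q.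
Qed.

Lemma far_preimage C (P Q : set X) :
  far P Q -> far (set_val @^-1` P : set (set_type C)) (set_val @^-1` Q).
Proof.
move=> h M; have [B hB] := h M; exists B => x y [Px [q Qq xq]] [Py [q' Qq' yq']].
by apply: hB; split=> //; [exists (set_val q)|exists (set_val q')].
Qed.

End Subspaces.

(** Metric form of the theorem on partitions: [m] pairs of far sets have
    separators whose common part is bounded. The sets [P j] and [Q j] are the
    two sides of a neighbourhood of the separator of index [j], and the
    separators of index [j > 0] are found inside the separator of index [0]. *)
Lemma asInd_separation (R : realType) (m : nat) (X : metricType R) :
  proper_metric X -> asInd_lt m X -> forall A B : nat -> set X,
  (forall j, far (A j) (B j)) ->
  exists P Q : nat -> set X,
    (forall j, [/\ A j `<=` P j, B j `<=` Q j & far (P j) (Q j)]) /\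
    metric_bounded [set x | ~ exists2 j, (j < m)%N & P j x \/ Q j x].
Proof.
elim: m X => [|m IH] X X_proper /= h A B AB.
  by exists A, B; split; [move=> j; split|apply: mboundedS h].
have [C [Ccl sepC indC]] := h _ _ ((far_asymptotically_disjoint _ _).1 (AB 0%N)).
pose A' j : set (set_type C) := set_val @^-1` closer (A j.+1) (B j.+1).
pose B' j : set (set_type C) := set_val @^-1` closer (B j.+1) (A j.+1).
have [j|P [Q [PQ cov]]] := IH _ (proper_subspace X_proper Ccl) indC A' B'.
  exact/far_preimage/far_closer.
pose P1 j := set_val @` P j `|` A j.+1.
pose Q1 j := set_val @` Q j `|` B j.+1.
(* Points of S near U lie in U', hence in T, which is far from S. *)
have farB (S T : set (set_type C)) (U U' : set X) : far S T -> far U (~` U') ->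
    set_val @^-1` U' `<=` T -> far (set_val @` S) U.
  move=> ST UU' U'T M.
  apply: mboundedS (mboundedU (far_meet (far_image ST)) (farC UU' M)).
  move=> _ [[s Ss <-] hu].
  have [U's|nU's] := pselect (U' (set_val s)); [left|by right].
  by split; exists s => //; exact: U'T.
have PQ1 j : far (P1 j) (Q1 j).
  have [AP BQ fPQ] := PQ j.
  apply: far_setUl; apply: far_setUr; first exact: far_image.
  - exact: farB fPQ (far_closerC (farC (AB j.+1))) BQ.
  - exact/farC/(farB _ _ _ _ (farC fPQ) (far_closerC (AB j.+1)) AP).
  - exact: AB.
pose P2 j := closer (P1 j) (Q1 j).
pose Q2 j := closer (Q1 j) (P1 j).
(* D is what the pairs of index j > 0 leave uncovered; it is far from C,
   because C is covered by P and Q up to a bounded set. *)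
pose D := [set x | ~ exists2 j, (j < m)%N & P2 j x \/ Q2 j x].
have CD : far C D.
  move=> M; have := mboundedU (mbounded_image cov) (mbounded_bigcup (n := m)
    (fun j _ => mboundedU (far_closerC (PQ1 j) M) (far_closerC (farC (PQ1 j)) M))).
  apply: mboundedS => c [Cc [d Dd cd]].
  pose c' : set_type C := exist _ c (mem_set Cc).
  have [[j jm hj]|nj] := pselect (exists2 j, (j < m)%N & P j c' \/ Q j c'); last first.
    by left; exists c'.
  right; exists j => //; case: hj => hj; [left|right]; split.
  - by left; exists c'.
  - by exists d => // Pd; apply: Dd; exists j => //; left.
  - by left; exists c'.
  - by exists d => // Pd; apply: Dd; exists j => //; right.
have [P0 [Q0 [PQ0 fPQ0 P0B Q0A]]] := asymptotic_separator_decomposition X_proper sepC CD.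
exists (fun j => if j is j'.+1 then P2 j' else P0 `|` A 0%N),
  (fun j => if j is j'.+1 then Q2 j' else Q0 `|` B 0%N); split.
  case=> [|j].
    split; [by right|by right|].
    apply: far_setUl; apply: far_setUr => //; exact: farC.
  split; last exact: far_closer.
    by apply: subset_trans (@sub_closer _ _ _ _) => x; right.
  by apply: subset_trans (@sub_closer _ _ _ _) => x; right.
apply: mboundedS (mbounded0 (X := X)) => x nx; apply: nx.
have [[j jm hj]|Dx] := pselect (exists2 j, (j < m)%N & P2 j x \/ Q2 j x).
  by exists j.+1.
have : D x by [].
by rewrite -PQ0 => -[?|?]; exists 0%N => //; [left|right]; left.
Qed.

(** * Compactness of colourings *)
Section Compactness.
Context {R : realType} {X : metricType R}.

(** An ultrafilter limit of colourings of larger and larger parts is a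
    colouring with the same constants, since a chain is a finite object. *)
Lemma colouring_compactness (D M : R) (n : nat) (S : set X) (F : nat -> set X) :
  (forall x, S x -> \forall s \near \oo, F s x) ->
  (forall s, exists c, colouring D M n (S `&` F s) c) ->
  exists c, colouring D M n S c.
Proof.
move=> SF /choice[c_ hc].
have [U [UU ooU]] := ultraFilterLemma (eventually_filter : ProperFilter \oo).
have UI P Q : U P -> U Q -> U (P `&` Q) by exact: filterI.
have UT : U setT by exact: filterT.
have US x : S x -> U [set s | F s x] by move=> /SF/ooU.
have /choice[c hcU] : forall x, exists k, S x -> U [set s | c_ s x = k].
  move=> x; have [Sx|] := pselect (S x); last by exists 0%N.
  apply: contrapT => nk.
  have Uk k : U [set s | ~ c_ s x = k].
    have [Ak|//] := in_ultra_setVsetC [set s | c_ s x = k] UU.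
    by case: nk; exists k.
  (* If no colour were chosen for almost all s, the colours would be unbounded. *)
  have Un m : U [set s | (m <= c_ s x)%N].
    elim: m => [|m IH]; first by apply: filterS UT.
    apply: filterS (UI _ _ IH (Uk m)) => s [/= ms nms].
    by rewrite ltn_neqAle ms andbT; apply/eqP => h; exact: nms.
  have /filter_ex[s [/= Fs ns]] := UI _ _ (US x Sx) (Un n).
  by have := (hc s).1 x (conj Sx Fs); rewrite ltnNge ns.
exists c; split=> [x Sx|k x y xy].
  have /filter_ex[s [/= Fs <-]] := UI _ _ (US x Sx) (hcU x Sx).
  by apply: (hc s).1.
have : U [set s | chain D [set z | (S `&` F s) z /\ c_ s z = k] x y].
  elim: xy => [a b [[Sa ak] [Sb bk] ab]|a|a b d _ IH1 _ IH2].
  - have := UI _ _ (UI _ _ (US a Sa) (hcU a Sa)) (UI _ _ (US b Sb) (hcU b Sb)).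
    apply: filterS => s [[/= Fa ca] [/= Fb cb]]; apply: rt_step.
    by split=> //; rewrite /= ?ca ?cb.
  - by apply: filterS UT => s _; exact: rt_refl.
  - by apply: filterS (UI _ _ IH1 IH2) => s [h1 h2]; exact: rt_trans h1 h2.
by move=> /filter_ex[s]; apply: (hc s).2.
Qed.

End Compactness.

(** An increasing family of [k.+1] subsets of [{0, ..., k}] from a nonempty
    subset to a proper one cannot be strictly increasing. *)
Lemma chain_of_subsets_stationary (k : nat) (T : nat -> nat -> Prop) :
  (forall l t, (l < k)%N -> T l t -> T l.+1 t) ->
  (exists2 t, (t <= k)%N & T 0%N t) -> (exists2 t, (t <= k)%N & ~ T k t) ->
  exists2 l, (l < k)%N & forall t, (t <= k)%N -> T l.+1 t -> T l t.
Proof.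
move=> Tm [t0 t0k Tt0] [t1 t1k nTt1].
pose N l := [set t : 'I_k.+1 | `[< T l t >]]%SET.
have NE l (t : 'I_k.+1) : (t \in N l) = `[< T l t >] by rewrite finset.inE.
apply: contrapT => nl.
have Nl l : (l <= k)%N -> (l < #|N l|)%N.
  elim: l => [_|l IH lk].
    apply/card_gt0P; exists (inord t0); rewrite NE; apply/asboolP.
    by rewrite inordK.
  apply: leq_ltn_trans (IH (ltnW lk)) _; apply: proper_card.
  apply/properP; split.
    by apply/fintype.subsetP => t; rewrite !NE => /asboolP h; apply/asboolP/Tm.
  apply: contrapT => np; apply: nl; exists l => // t tk Tt.
  apply: contrapT => nTt; apply: np; exists (inord t); rewrite NE inordK//.
    exact/asboolP.
  by apply/negP => /asboolP.
have := Nl k (leqnn k); rewrite ltnNge => /negP; apply.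
have : (#|N k| < #|[set: 'I_k.+1]%SET|)%N.
  apply: proper_card; apply/properP; split; first exact: finset.subsetT.
  exists (inord t1); first by rewrite finset.inE.
  by rewrite NE inordK//; apply/negP => /asboolP.
by rewrite cardsT card_ord ltnS.
Qed.

(** * From asymptotic separators to colourings *)
Section Lowering.
Context {R : realType} {X : metricType R}.
Implicit Types (D M : R).

Definition annulus (x0 : X) (r s : R) := [set x | r <= mdist x0 x < s].

Lemma uncolourable_annulus (x0 : X) D n :
  (forall M (E : set X) c, metric_bounded E -> ~ colouring D M n (~` E) c) ->
  forall M r, exists s, forall c, ~ colouring D M n (annulus x0 r s) c.
Proof.
move=> h M r; apply: contrapT => ns.
have [||c hc] := @colouring_compactness _ _ D M n [set x | r <= mdist x0 x]
    (fun s => [set x | mdist x0 x < s%:R]).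
- move=> x _; exists (Num.truncn (mdist x0 x)).+1 => // s /= xs.
  by apply: lt_le_trans (truncnS_gt _) _; rewrite ler_nat.
- move=> s; apply: contrapT => nc; apply: ns; exists s%:R => c hc.
  apply: nc; exists c; apply: colouringW hc => // x [/= rx xs].
  by rewrite /annulus /= rx.
- apply: (h M [set x | mdist x0 x < r] c).
    by apply/(mbounded_ballP _ x0); exists r.
  by apply: colouringW hc => // x /negP; rewrite -leNgt.
Qed.

(** Radii growing fast enough for the annuli from [r i] to [s i (r i)] to be
    separated by gaps tending to infinity. *)
Lemma spread_radii (a : nat -> R) (s : nat -> R -> R) :
  exists r : nat -> R, forall i j, (i <= j)%N ->
    [/\ a i <= r i, i%:R + a 0%N <= r i & (i < j)%N -> s i (r i) + i.+1%:R <= r j].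
Proof.
pose r := fix r i : R := if i is i'.+1 then
  Num.max (a i) (Num.max (s i' (r i') + i'.+1%:R) (r i' + 1)) else a 0%N.
have rS i : [/\ a i.+1 <= r i.+1, s i (r i) + i.+1%:R <= r i.+1 & r i + 1 <= r i.+1].
  by split; rewrite /= !le_max lexx ?orbT.
have rm i j : (i <= j)%N -> r i <= r j.
  move=> /subnK <-; elim: (j - i)%N => [|d IH]; first by rewrite add0n.
  by rewrite addSn; have [_ _] := rS (d + i)%N; lra.
exists r => i j ij; split.
- by case: i {ij} => [//|i]; have [] := rS i.
- elim: i {ij} => [|i IH]; first by rewrite add0r.
  by have [_ _] := rS i; rewrite -natr1; lra.
- by move=> /rm; have [_ h _] := rS i; exact: le_trans.
Qed.

Section OneAnnulus.
Variables (k : nat) (lam : R) (lam0 : 0 < lam) (P : nat -> set X).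

(** Thresholds decreasing from [k.+1 * lam] to [lam] as [l] grows from [0] to
    [k], in steps of [lam]. *)
Definition level (l : nat) : R := (k.+1 - l)%:R * lam.

(** The set of coordinates which are not small at [x], where smallness is
    measured by [level l]. For [t < k] the coordinate of index [t] is the
    distance to [P t]. The coordinate of index [k] is [2 * level 0] minus the
    largest of these distances; like a barycentric coordinate, it is large when
    all the others are small. *)
Definition active (l : nat) (x : X) (t : nat) : Prop :=
  ((t < k)%N /\ forall p, P t p -> level l <= mdist x p) \/
  (t = k /\ forall j, (j < k)%N ->
     exists2 p, P j p & mdist x p < 2 * level 0 - level l).

Lemma levelS l : (l < k.+1)%N -> level l = level l.+1 + lam.
Proof. by move=> lk; rewrite /level subSn// -natr1 mulrDl mul1r subSS. Qed.

Lemma active_near l x y t : (l < k.+1)%N -> mdist x y <= lam ->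
  active l x t -> active l.+1 y t.
Proof.
move=> /levelS lS xy [[tk h]|[-> h]]; [left|right]; split=> //.
  move=> p /h; have := metric_triangle x y p; lra.
move=> j /h[p Pp xp]; exists p => //.
have := metric_triangle y x p; rewrite (metric_sym y x); lra.
Qed.

(** If all distances to the [P j] are less than [level 0], then the last
    coordinate exceeds [2 * level 0 - level 0]. *)
Lemma active0 x : exists2 t, (t <= k)%N & active 0 x t.
Proof.
have [[j [jk h]]|h] := pselect (exists j, (j < k)%N /\
    forall p, P j p -> level 0 <= mdist x p).
  by exists j; [exact: ltnW|left].
exists k => //; right; split=> // j jk; apply: contrapT => np; apply: h.
exists j; split=> // p Pp; rewrite leNgt; apply/negP => xp; apply: np.
by exists p => //; lra.
Qed.

Lemma active_stationary x : (exists2 t, (t <= k)%N & ~ active k x t) ->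
  exists2 l, (l < k)%N & forall t, (t <= k)%N -> active l.+1 x t -> active l x t.
Proof.
move=> h; apply: chain_of_subsets_stationary => // [l t lk|]; last exact: active0.
by apply: active_near; rewrite ?mdistxx ?ltW// (ltn_trans lk).
Qed.

Lemma activeW x t l : (l <= k)%N -> active 0 x t -> active l x t.
Proof.
elim: l => [//|l IH] lk h; apply: (@active_near l x x); rewrite ?mdistxx ?ltW//.
  by rewrite ltnS ltnW.
exact: IH (ltnW lk) h.
Qed.

(** If at each point of [F] some coordinate is not active, the active sets
    stop growing between some [l] and [l.+1], with [l < k]; colour the point by
    such an [l]. Along a chain of a given colour the active set at level [l] is
    then constant. It contains a coordinate [t], which is witnessed along the
    whole chain by points of colour [t] for [c]; these form a [c]-chain at scale
    [2 * i + lam]. *)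
Lemma colouring_of_witnesses (i M : R) (F S : set X) (c : X -> nat) :
  0 <= i -> colouring (2 * i + lam) M k.+1 S c ->
  (forall x, F x -> exists2 t, (t <= k)%N & ~ active k x t) ->
  (forall x l t, F x -> (l < k)%N -> active l x t ->
     exists y, [/\ S y, c y = t & mdist x y <= i]) ->
  exists d, colouring lam (`|M| + 2 * i) k F d.
Proof.
move=> i0 [_ cM] Fn Fw.
have /choice[d hd] : forall x, exists l, F x ->
    (l < k)%N /\ forall t, (t <= k)%N -> active l.+1 x t -> active l x t.
  move=> x; have [Fx|] := pselect (F x); last by exists 0%N.
  by have [l lk hl] := active_stationary (Fn x Fx); exists l.
exists d; split=> [x /hd[]//|l x y xy].
have M0 := normr_ge0 M.
have [xy0|[Fx dx]] := chain_end (chain_sym xy); first by rewrite xy0 mdistxx; lra.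
have [lk _] := hd x Fx; rewrite dx in lk.
have [t tk t0] := active0 x.
have tl := activeW (ltnW lk) t0.
have [u [Su cu xu]] := Fw _ _ _ Fx lk tl.
(* Carries along the chain a witness v linked to the first witness u. *)
pose I z := active l z t /\ exists2 v, mdist z v <= i &
  chain (2 * i + lam) [set z | S z /\ c z = t] u v.
have [_ [v yv uv]] : I y.
  apply: (clos_rt_inv (I := I)) xy _; last by split=> //; exists u => //; exact: rt_refl.
  move=> a b [[Fa da] [Fb db] ab] [ta [v av uv]].
  have [_ hb] := hd b Fb; rewrite db in hb.
  have tb : active l b t by apply: hb => //; apply: active_near ab ta; rewrite ltnS ltnW.
  split=> //; have [w [Sw cw bw]] := Fw _ _ _ Fb lk tb.
  exists w => //; apply: (rt_trans _ _ _ _ _ uv); apply: rt_step; split=> //.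
    by have [<-|] := chain_end uv.
  have := metric_triangle v a w; have := metric_triangle a b w.
  rewrite (metric_sym v a); lra.
have := cM _ _ _ uv; have := ler_norm M.
have := metric_triangle x u y; have := metric_triangle u v y.
rewrite (metric_sym v y); lra.
Qed.

End OneAnnulus.

(** The sets [A j] and [B j] are far since on the annulus of index [i] they
    are at distance more than [i], and distinct annuli recede from each other.
    On a distant annulus the sets [P j], [Q j] obtained from them satisfy the
    hypotheses of [colouring_of_witnesses], which produces a colouring that
    the annulus was chosen not to have. *)
Lemma asInd_lt_asdim_lt (m k : nat) : proper_metric X -> asInd_lt m X ->
  (m <= k)%N -> asdim_lt k.+1 X -> asdim_lt k X.
Proof.
move=> X_proper indX mk dimX; apply: contrapT => /existsNP[D0 nD0].
have [x0 _] : exists x : X, True.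
  apply: contrapT => nX; apply: nD0; exists 0, setT, (fun=> 0%N).
  by split; [exists 0 => x; case: nX; exists x|split=> [x|? x]; case: nX; exists x].
pose lam := Num.max D0 1.
have lam0 : 0 < lam by rewrite lt_max ltr01 orbT.
have nlam M (E : set X) c : metric_bounded E -> ~ colouring lam M k (~` E) c.
  move=> Eb hc; apply: nD0; exists M, E, c; split=> //.
  by apply: colouringW hc => //; rewrite le_max lexx.
have /choice[M] : forall i : nat, exists M : R, exists a (c : X -> nat),
    colouring (2 * i%:R + lam) M k.+1 [set x | a <= mdist x0 x] c.
  move=> i; have [M [E [c [/(mbounded_ballP _ x0)[r hr] hc]]]] := dimX (2 * i%:R + lam).
  exists M, r, c; apply: colouringW hc => // x /= rx /hr; apply/negP.
  by rewrite -leNgt.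
move=> /choice[a] /choice[c hc].
have /choice[s] : forall i, exists s : R -> R, forall r f,
    ~ colouring lam (`|M i| + 2 * i%:R) k (annulus x0 r (s r)) f.
  move=> i; have /choice[s hs] := uncolourable_annulus x0 nlam (`|M i| + 2 * i%:R).
  by exists s.
move=> hs; have [r hr] := spread_radii a s.
pose F i := annulus x0 (r i) (s i (r i)).
(* The points with a neighbour of colour j within i, in the i-th colouring. *)
pose near i x j := exists y, [/\ a i <= mdist x0 y, c i y = j & mdist x y <= i%:R].
pose A j := [set x | exists2 i, F i x & ~ near i x j].
pose B j := [set x | exists2 i, F i x & c i x = j].
have FaM i x : F i x -> a i <= mdist x0 x.
  by move=> /andP[rx _]; have [ai _ _] := hr i i (leqnn i); exact: le_trans rx.
have AB j : far (A j) (B j).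
  move=> t; apply/(mbounded_ballP _ x0).
  pose N := (Num.truncn t).+1; exists (r N.+1 + `|t|).
  move=> x [[i Fix nx] [y [l Fly cy] xy]].
  have small q : q%:R < t -> (q < N.+1)%N.
    move=> qt; rewrite -(ltr_nat R); apply: (lt_trans qt).
    apply: lt_le_trans (truncnS_gt _) _; by rewrite ler_nat.
  have rs q : q%:R < t -> s q (r q) <= r N.+1.
    move=> qt; have [_ _ /(_ (small _ qt))] := hr q N.+1 (ltnW (small _ qt)).
    by have : 0 <= q.+1%:R :> R by []; lra.
  have t0 : 0 < t by apply: le_lt_trans (mdist_ge0 x y) xy.
  rewrite gtr0_norm//; move: (Fix) (Fly) => /andP[rx xs] /andP[ry ys].
  have [il|li|il] := ltngtP i l.
  - have [_ _ /(_ il)] := hr i l (ltnW il); rewrite -natr1 => sr.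
    have it : i%:R < t by have := metric_triangle x0 x y; lra.
    by have := rs _ it; lra.
  - have [_ _ /(_ li)] := hr l i (ltnW li); rewrite -natr1 => sr.
    have := metric_triangle x0 y x; rewrite (metric_sym y x) => tr.
    have lt : l%:R < t by lra.
    by have := rs _ lt; lra.
  - subst l; have it : i%:R < t.
      apply: lt_trans xy; rewrite ltNge; apply/negP => xy; apply: nx.
      by exists y; split=> //; exact: FaM.
    by have := rs _ it; lra.
have [P [Q [PQ cov]]] := asInd_separation X_proper indX AB.
(* Beyond r0 the space is covered, and P j and Q j are at least Lam apart. *)
pose Lam := 2 * level k lam 0.
have fPQ j : far (P j) (Q j) by have [] := PQ j.
have := mboundedU cov (mbounded_bigcup (n := k) (fun j _ => fPQ j Lam)).
move=> /(mbounded_ballP _ x0)[r0 hr0].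
pose i := (Num.truncn (r0 - a 0%N)).+1.
have ri : r0 <= r i.
  have [_ ir _] := hr i i (leqnn i).
  by have : r0 - a 0%N < i%:R := truncnS_gt _; lra.
pose P' j := P j `&` [set x | r0 <= mdist x0 x].
have P'Q j p q : (j < k)%N -> P' j p -> Q j q -> Lam <= mdist p q.
  move=> jk [Pp /= r0p] Qq; rewrite leNgt; apply/negP => pq.
  have : mdist x0 p < r0 by apply: hr0; right; exists j => //; split=> //; exists q.
  by lra.
have Fr x : F i x -> r0 <= mdist x0 x by move=> /andP[rx _]; exact: le_trans rx.
have levk l : (l <= k)%N -> 0 < level k lam l.
  by move=> lk; rewrite mulr_gt0// ltr0n subn_gt0 ltnS.
have [||d hd] := colouring_of_witnesses (P := P') lam0 (F := F i) (ler0n R i) (hc i).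
- move=> x Fx.
  have [[j jm hj]|nj] := pselect (exists2 j, (j < m)%N & P j x \/ Q j x); last first.
    by have := hr0 x (or_introl nj); have := Fr x Fx; lra.
  have jk := leq_trans jm mk; case: hj => [Px|Qx].
    exists j; first exact: ltnW.
    case=> [[_ /(_ x)]|[jE _]]; last by rewrite jE ltnn in jk.
    rewrite mdistxx => /(_ (conj Px (Fr x Fx))).
    by have := levk k (leqnn k); lra.
  exists k => //; case=> [[]|[_ /(_ j jk)[p Pp xp]]]; first by rewrite ltnn.
  have := P'Q j p x jk Pp Qx; rewrite (metric_sym p x) /Lam.
  by have := levk k (leqnn k); lra.
- move=> x l t Fx lk [[tk h]|[-> h]].
    apply: contrapT => nw; have [/(_ x) AP _ _] := PQ t.
    have Ax : A t x by exists i.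
    have := h x (conj (AP Ax) (Fr x Fx)); rewrite mdistxx.
    by have := levk l (ltnW lk); lra.
  exists x; split; [exact: FaM| |by rewrite mdistxx].
  have [/(_ x (FaM _ _ Fx)) ck _] := hc i.
  apply/eqP; rewrite eqn_leq -ltnS ck /= leqNgt; apply/negP => cxk.
  have [p Pp xp] := h _ cxk; have [_ /(_ x) BQ _] := PQ (c i x).
  have Bx : B (c i x) x by exists i.
  have := P'Q _ p x cxk Pp (BQ Bx); rewrite (metric_sym p x) /Lam.
  by have := levk l (ltnW lk); lra.
- exact: hs hd.
Qed.

End Lowering.

(** * Separators from colourings at all scales *)
Section Nets.
Context {R : realType} {X : metricType R}.

Lemma exists_net (rho : R) (Y : set X) : 0 < rho -> exists N : set X,
  [/\ N `<=` Y, forall x y, N x -> N y -> x <> y -> rho <= mdist x y &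
      forall y, Y y -> exists2 x, N x & mdist y x < rho].
Proof.
move=> rho0.
pose sep (N : set X) := N `<=` Y /\
  forall x y, N x -> N y -> x <> y -> rho <= mdist x y.
have [F Fsep Ftot|N [[NY Nsep] Nmax]] := @Zorn_bigcup X sep.
  split=> [x [N FN Nx]|x y [N FN Nx] [N' FN' N'y]].
    by have [h _] := Fsep N FN; exact: h.
  have [NN'|N'N] := Ftot _ _ FN FN'.
    by have [_ h] := Fsep N' FN'; apply: h => //; exact: NN'.
  by have [_ h] := Fsep N FN; apply: h => //; exact: N'N.
exists N; split=> // y Yy; apply: contrapT => ny.
have nyN x : N x -> rho <= mdist y x.
  by move=> Nx; rewrite leNgt; apply/negP => yx; apply: ny; exists x.
apply: (Nmax (N `|` [set y])); last first.
  split=> [x [/NY//|->//]|x z [Nx|->] [Nz|->]] xz //.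
  - exact: Nsep.
  - by rewrite metric_sym; exact: nyN.
  - exact: nyN.
split; first by move=> x; left.
move=> /(_ y (or_intror erefl)) Ny.
by apply: ny; exists y => //; rewrite mdistxx.
Qed.

Lemma closed_separated (C : set X) :
  (forall x y, C x -> C y -> x <> y -> 1 <= mdist x y) -> closed C.
Proof.
move=> Csep z zC.
have near r : 0 < r -> exists2 c, C c & mdist z c < r.
  move=> r0; have [c [Cc]] := zC _ (nbhsx_ballx z r r0).
  by rewrite ballEmdist => zc; exists c.
have [|c Cc zc] := near (1 / 2); first by rewrite divr_gt0.
have [->//|zNc] := eqVneq z c.
have [|c' Cc' zc'] := near (Num.min (mdist z c) (1 / 2)).
  by rewrite lt_min mdist_gt0 zNc divr_gt0.
move: zc'; rewrite lt_min => /andP[c'c c'1].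
have cc' : c <> c' by move=> cc'; move: c'c; rewrite cc' ltxx.
have := Csep _ _ Cc Cc' cc'; have := metric_triangle c z c'.
rewrite (metric_sym c z); lra.
Qed.

End Nets.

(** The map [col D] is a colouring at scale [D] with bound [bnd D], valid
    outside the ball of radius [inner D]. The map [psi] bounds the positions of
    close pairs of points in two far sets; see [far_linked]. *)
Section Hierarchy.
Context {R : realType} {X : metricType R}.
Variables (x0 : X) (n : nat) (bnd inner psi : R -> R) (col : R -> X -> nat).
Hypothesis bnd_ge0 : forall D, 0 <= bnd D.
Hypothesis colP : forall D,
  colouring D (bnd D) n.+1 [set x | inner D <= mdist x0 x] (col D).

(** The scales. Each exceeds by far the size [beta] of the classes of linked
    points formed with the zones of smaller index; see [rhoS]. *)
Fixpoint rho (k : nat) : R :=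
  if k is k'.+1 then bnd (rho k') + 4 * rho k' + 1 else 0.

Definition beta k := bnd (rho k) + 2 * rho k.

(** The term in [psi] places the zone of index [k] where the two far sets are
    at a distance larger than the size [beta k] of linked classes. *)
Definition rad k := Num.max (inner (rho k))
  (Num.max k%:R (beta k + psi (2 * beta k))).

Lemma rho_ge0 k : 0 <= rho k.
Proof. by elim: k => //= k IH; have := bnd_ge0 (rho k); lra. Qed.

Lemma rhoS k : rho k.+1 = beta k + 2 * rho k + 1.
Proof. by rewrite /= /beta; lra. Qed.

Lemma beta_ge k : 2 * rho k <= beta k.
Proof. by rewrite /beta; have := bnd_ge0 (rho k); lra. Qed.

Lemma rho_lt j k : (j < k)%N -> rho j + 1 <= rho k.
Proof.
elim: k => [//|k IH]; rewrite ltnS leq_eqVlt rhoS => /orP[/eqP->|/IH];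
by have := beta_ge k; have := rho_ge0 k; lra.
Qed.

Lemma rho_le j k : (j <= k)%N -> rho j <= rho k.
Proof. by rewrite leq_eqVlt => /orP[/eqP->//|/rho_lt]; lra. Qed.

Lemma rho_ge k : k%:R <= rho k.
Proof. by elim: k => //= k IH; rewrite -natr1; have := bnd_ge0 (rho k); have := rho_ge0 k; lra. Qed.

Definition zone k : set X :=
  [set x | [/\ (0 < k)%N, col (rho k) x = 0%N & rad k <= mdist x0 x]].

(** Only finitely many zones contain a given point, since [k <= rad k]. The
    level of a point is the largest index of these zones, or [0]. *)
Lemma exists_level : exists lev : X -> nat,
  (forall x, lev x = 0%N \/ zone (lev x) x) /\
  (forall x k, zone k x -> (k <= lev x)%N).
Proof.
have /choice[lev hlev] : forall x, exists l,
    (l = 0%N \/ zone l x) /\ (forall k, zone k x -> (k <= l)%N).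
  move=> x; pose p l := `[< l = 0%N \/ zone l x >].
  have ex : exists l, p l by exists 0%N; apply/asboolP; left.
  have ub l : p l -> (l <= Num.truncn (mdist x0 x))%N.
    move=> /asboolP[->//|[_ _]]; rewrite /rad !ge_max => /andP[_ /andP[h _]].
    by rewrite truncn_ge_nat ?mdist_ge0.
  have [l /asboolP pl lmax] := ex_maxnP ex ub.
  by exists l; split=> // k zk; apply: lmax; apply/asboolP; right.
by exists lev; split=> x; have [] := hlev x.
Qed.

Variable lev : X -> nat.
Hypothesis levP : forall x, lev x = 0%N \/ zone (lev x) x.
Hypothesis lev_max : forall x k, zone k x -> (k <= lev x)%N.

Definition step k (x y : X) :=
  [/\ (0 < lev x <= k)%N, (0 < lev y <= k)%N & mdist x y <= rho (minn (lev x) (lev y))].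

Definition reach k := clos_refl_trans X (step k).

Lemma step_sym k x y : step k x y -> step k y x.
Proof. by case=> ? ? ?; split=> //; rewrite metric_sym minnC. Qed.

Lemma reach_sym k x y : reach k x y -> reach k y x.
Proof. by apply: clos_rt_sym => a b; exact: step_sym. Qed.

Lemma reach_end k x y : reach k x y -> x = y \/ (lev y <= k)%N.
Proof.
move=> h; apply: (clos_rt_inv (I := fun y => x = y \/ (lev y <= k)%N)) h _; last by left.
by move=> a b [_ /andP[_ bk] _] _; right.
Qed.

Lemma reachW k l x y : (k <= l)%N -> reach k x y -> reach l x y.
Proof.
move=> kl; apply: clos_rt_mono => a b [/andP[a0 ak] /andP[b0 bk] ab].
by split; rewrite ?a0 ?b0 /= ?(leq_trans _ kl).
Qed.

(** From [y] one arrives at [b], a point of level [k.+1] in the applications,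
    through points of level at most [k] only. *)
Definition hook k (y b : X) := y = b \/
  exists w, [/\ reach k y w, (lev w <= k)%N & mdist w b <= rho k].

Lemma hook_eq k y b : (k < lev y)%N -> hook k y b -> y = b.
Proof.
move=> ky [//|[w [yw wk _]]].
have [wy|] := reach_end (reach_sym yw); last by rewrite leqNgt ky.
by rewrite wy leqNgt ky in wk.
Qed.

(** By induction on the level [k], as in the union theorem for asymptotic
    dimension. A path that visits level [k.+1] leads to a first such point,
    then from one such point to the next, and finally away from the last one.
    The excursions between them have levels at most [k], hence length at most
    [beta k + 2 * rho k <= rho k.+1]. The visited points of level [k.+1] thus
    form a chain of colour [0] at scale [rho k.+1]. *)
Lemma reach_dist k x y : reach k x y -> mdist x y <= beta k.
Proof.
elim: k x y => [|k IH] x y xy.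
  have -> : x = y.
    apply: (clos_rt_inv (I := eq x)) xy erefl => a b [/andP[a0 a1]].
    by rewrite leqNgt a0 in a1.
  by rewrite mdistxx; apply: le_trans (beta_ge 0); rewrite /= mulr0.
have hook_dist z b : hook k z b -> mdist z b <= beta k + rho k.
  case=> [->|[w [zw _ wb]]].
    by rewrite mdistxx; have := beta_ge k; have := rho_ge0 k; lra.
  by have := IH _ _ zw; have := metric_triangle z w b; lra.
have step_le a b : step k.+1 a b -> (lev b <= k)%N -> mdist a b <= rho k.
  move=> [_ _ ab] bk; apply: le_trans ab _; apply: rho_le.
  exact: leq_trans (geq_minr _ _) bk.
(* Points of level k.+1 have colour 0 at scale rho k.+1. *)
pose S := [set z | [set x | inner (rho k.+1) <= mdist x0 x] z /\ col (rho k.+1) z = 0%N].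
have levS z : lev z = k.+1 -> S z.
  move=> zk; have [|] := levP z; first by rewrite zk.
  by rewrite zk => -[_ z0]; rewrite /rad ge_max => /andP[].
(* a and b are the first and the last point of level k.+1 met so far. *)
pose I y := reach k x y \/ exists a b,
  [/\ lev b = k.+1, mdist x a <= rho k.+1, chain (rho k.+1) S a b & hook k y b].
have top z : (lev z <= k.+1)%N -> (k < lev z)%N -> lev z = k.+1.
  by move=> h1 h2; apply/eqP; rewrite eqn_leq h1.
have : I y.
  apply: (clos_rt_inv (I := I)) xy _; last by left; exact: rt_refl.
  move=> {}y z yz; have zy := step_sym yz.
  have [/andP[y0 yk] /andP[z0 zk] yzd] := yz.
  have rk := rhoS k; have rk0 := rho_ge0 k; have bk0 := beta_ge k.
  case=> [xy|[a [b [bk xa ab yb]]]]; have [zk'|zk'] := leqP (lev z) k.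
  - have [yk'|yk'] := leqP (lev y) k.
      left; apply: (rt_trans _ _ _ _ _ xy); apply: rt_step.
      split; rewrite ?y0 ?z0//.
    have [xy0|] := reach_end xy; last by rewrite leqNgt yk'.
    right; exists y, y; split; [exact: top|by rewrite xy0 mdistxx; lra|exact: rt_refl|].
    right; exists z; split=> //; first exact: rt_refl.
    by rewrite metric_sym; exact: step_le.
  - right; have [yk'|yk'] := leqP (lev y) k.
      exists z, z; split; [exact: top| |exact: rt_refl|by left].
      have := step_le _ _ zy yk'; rewrite (metric_sym z y).
      by have := IH _ _ xy; have := metric_triangle x y z; lra.
    have [xy0|] := reach_end xy; last by rewrite leqNgt yk'.
    exists y, z; split; [exact: top|by rewrite xy0 mdistxx; lra| |by left].
    apply: rt_step; split; [exact/levS/top|exact/levS/top|].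
    by apply: le_trans yzd _; apply: rho_le; rewrite geq_min yk.
  - right; exists a, b; split=> //; right.
    have [yk'|yk'] := leqP (lev y) k.
      case: yb => [yb|[w [yw wk wb]]]; first by rewrite yb bk ltnn in yk'.
      exists w; split=> //; apply: rt_trans yw; apply: rt_step.
      by split; rewrite ?y0 ?z0// metric_sym minnC.
    exists z; split=> //; first exact: rt_refl.
    by rewrite -(hook_eq yk' yb) metric_sym; exact: step_le.
  - right; exists a, z; split=> //; [exact: top| |by left].
    apply: (rt_trans _ _ _ _ _ ab); apply: rt_step.
    split; [exact: levS|exact/levS/top|].
    have [yk'|yk'] := leqP (lev y) k.
      have := step_le _ _ zy yk'; have := hook_dist _ _ yb.
      have := metric_triangle b y z; rewrite (metric_sym b y) (metric_sym z y); lra.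
    rewrite -(hook_eq yk' yb); apply: le_trans yzd _; apply: rho_le.
    by rewrite geq_min yk.
case=> [/IH|[a [b [bk xa ab yb]]]].
  by have := beta_ge k.+1; rewrite rhoS; have := rho_ge0 k; have := beta_ge k; lra.
have := (colP (rho k.+1)).2 _ _ _ ab; have := hook_dist _ _ yb.
have := metric_triangle x a y; have := metric_triangle a b y.
rewrite (metric_sym b y) [beta k.+1]/beta rhoS in xa *.
by have := rho_ge0 k; lra.
Qed.

Definition linked := clos_refl_trans X (fun x y => exists k, step k x y).

(** A nontrivial path reaches a zone whose index is its maximal level. *)
Lemma linked_peak x y : linked x y -> x = y \/
  exists k z, [/\ reach k x y, reach k x z & zone k z].
Proof.
move=> xy.
have ex : exists k, `[< reach k x y >].
  elim: xy => [a b [k ab]|a|a b c _ [k /asboolP ab] _ [l /asboolP bc]].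
  - by exists k; apply/asboolP/rt_step.
  - by exists 0%N; apply/asboolP/rt_refl.
  - exists (maxn k l); apply/asboolP; apply: (@rt_trans _ _ _ b).
      by apply: reachW ab; exact: leq_maxl.
    by apply: reachW bc; exact: leq_maxr.
case: (ex_minnP ex) => -[|k] /asboolP kxy kmin; [left|right].
  apply: (clos_rt_inv (I := eq x)) kxy erefl => a b [/andP[a0 a1]].
  by rewrite leqNgt a0 in a1.
pose I y := reach k x y \/ exists z, reach k.+1 x z /\ lev z = k.+1.
suff [h|[z [xz zk]]] : I y.
  by have /asboolP/kmin := h; rewrite ltnn.
- exists k.+1, z; split=> //.
  by have [|] := levP z; rewrite zk.
- apply: (clos_rt_inv (I := I)) kxy _; last by left; exact: rt_refl.
  move=> a b ab [xa|]; last by right.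
  have [/andP[a0 ak] /andP[b0 bk] abd] := ab.
  have xa' := reachW (leqnSn k) xa.
  have [ak'|ak'] := leqP (lev a) k; last first.
    by right; exists a; split=> //; apply/eqP; rewrite eqn_leq ak.
  have [bk'|bk'] := leqP (lev b) k; last first.
    right; exists b; split; last by apply/eqP; rewrite eqn_leq bk.
    by apply: rt_trans xa' _; exact: rt_step.
  left; apply: (rt_trans _ _ _ _ _ xa); apply: rt_step.
  by split; rewrite ?a0 ?b0.
Qed.

(** Let [p] be linked to [a] in [A] and within [M] of [b] in [B], and let [k]
    be the peak of the path. If [M <= beta k], then [a] and [b] are within
    [2 * beta k], which is impossible so close to the zone of index [k]. If
    [beta k < M], then [a] and [b] are within [2 * M], which bounds the
    position of [a] and of [p]. *)
Lemma far_linked (A B : set X) :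
  (forall t a b, A a -> B b -> mdist a b < t -> mdist x0 a < psi t) ->
  far [set x | exists2 a, A a & linked a x] B.
Proof.
move=> AB M; apply/(mbounded_ballP _ x0).
exists (`|psi M| + `|psi (2 * M)| + `|M| + 1).
move=> p [[a Aa ap] [b Bb pb]].
have h1 := normr_ge0 (psi M); have h2 := normr_ge0 (psi (2 * M)).
have h3 := normr_ge0 M; have h4 := ler_norm (psi M).
have h5 := ler_norm (psi (2 * M)); have h6 := ler_norm M.
case: (linked_peak ap) => [pE|[k [z [rp rz [_ _]]]]].
  by subst p; have := AB _ _ _ Aa Bb pb; lra.
rewrite /rad !ge_max => /andP[_ /andP[_ zk]].
have := reach_dist rp; have := reach_dist rz => az ap'.
have ab := metric_triangle a p b; have t1 := metric_triangle x0 a z.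
have t2 := metric_triangle x0 a p.
have [Mk|kM] := leP M (beta k).
  have : mdist x0 a < psi (2 * beta k) by apply: AB Aa Bb _; lra.
  lra.
have : mdist x0 a < psi (2 * M) by apply: AB Aa Bb _; lra.
lra.
Qed.

(** Points outside the zones of index at least [J], far from the points outside
    those of index at least [J.-1], which the previous nets account for. *)
Definition net_domain J : set X := [set x | [/\ (lev x < J)%N, rad J <= mdist x0 x &
  forall y, (lev y < J.-1)%N -> rho J <= mdist x y]].

(** Nets of the sets [net_domain J] with mesh [rho J]. By induction on [J],
    a point of level less than [J] is close to one of the first [J] nets or
    lies in a ball. *)
Lemma exists_skeleton : exists N : nat -> set X,
  [/\ forall J, N J `<=` net_domain J,
      forall J K x y, (J <= K)%N -> N J x -> N K y -> x <> y -> rho K <= mdist x y &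
      forall J, exists r, forall x, (lev x < J)%N ->
        mdist x0 x < r \/ exists2 c, (\bigcup_K N K) c & mdist x c < r].
Proof.
have /choice[N hN] : forall J, exists N : set X,
    [/\ N `<=` net_domain J, forall x y, N x -> N y -> x <> y -> rho J <= mdist x y &
      forall y, net_domain J y -> exists2 x, N x & mdist y x < rho J].
  case=> [|J].
    exists set0; split=> // x []; by rewrite ltn0.
  by apply: exists_net; rewrite rhoS; have := beta_ge J; have := rho_ge0 J; lra.
exists N; split.
- by move=> J; have [] := hN J.
- move=> J K x y; rewrite leq_eqVlt => /orP[/eqP<-|JK] Nx Ny xy.
    by have [_ h _] := hN J; exact: h.
  have [NJ _ _] := hN J; have [NK _ _] := hN K.
  have [xJ _ _] := NJ _ Nx; have [_ _ h] := NK _ Ny.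
  rewrite metric_sym; apply: h; apply: leq_trans xJ _.
  by case: K JK {NK Ny}.
- elim=> [|J [r hr]]; first by exists 0.
  exists (Num.max (rad J.+1) (`|r| + rho J.+1)) => x xJ.
  have r0 := normr_ge0 r; have r1 := ler_norm r; have rho0 := rho_ge0 J.+1.
  have [xr|xr] := ltP (mdist x0 x) (rad J.+1).
    by left; rewrite lt_max xr.
  have [xc|/existsNP[y /not_implyP[yJ /negP]]] :=
      pselect (forall y, (lev y < J)%N -> rho J.+1 <= mdist x y).
    have [_ _ /(_ x)[//|c Nc xc']] := hN J.+1.
    by right; exists c; [exists J.+1|rewrite lt_max; apply/orP; right; lra].
  rewrite -ltNge => xy; case: (hr y yJ) => [yr|[c Cc yc]]; [left|right].
    rewrite lt_max; apply/orP; right.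
    by have := metric_triangle x0 y x; rewrite (metric_sym y x); lra.
  exists c => //; rewrite lt_max; apply/orP; right.
  by have := metric_triangle x y c; lra.
Qed.

(** At the scale [rho j], the points of the nets of index greater than [j] are
    isolated. The other points have level less than [j], so far away their
    colour at scale [rho j] is one of [1, ..., n]. *)
Lemma asdim_lt_skeleton (N : nat -> set X) (C : set X) :
  (forall J, N J `<=` net_domain J) ->
  (forall J K x y, (J <= K)%N -> N J x -> N K y -> x <> y -> rho K <= mdist x y) ->
  C `<=` \bigcup_K N K -> asdim_lt n (set_type C).
Proof.
move=> Ndom Nsep CN D; pose j := (Num.truncn D).+1.
have Dj : D <= rho j by apply: le_trans (rho_ge j); exact/ltW/truncnS_gt.
(* Colour 0 far away would put the point in the zone of index k. *)
have colN k x : (0 < k)%N -> (lev x < k)%N -> rad k <= mdist x0 x ->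
    (0 < col (rho k) x < n.+1)%N.
  move=> k0 xk xr; apply/andP; split; last first.
    apply: (colP (rho k)).1; apply: le_trans xr.
    by rewrite /rad le_max lexx.
  rewrite lt0n; apply/eqP => h.
  have := @lev_max x k; rewrite leqNgt xk => h'.
  by apply: notF; apply: h'; split.
exists (bnd (rho j)), [set c | mdist x0 (set_val c) < rad j],
  (fun c => if (lev (set_val c) < j)%N then (col (rho j) (set_val c)).-1 else 0%N).
split.
  exists (rad j + rad j) => c d /= xc xd.
  have := metric_triangle (set_val c) x0 (set_val d).
  rewrite (metric_sym (set_val c) x0) => h; apply: le_trans h _; lra.
split=> [c /negP|k c d cd].
  rewrite -leNgt => cj; case: ifP => [lc|_].
    by have /andP[h1 h2] := colN j _ isT lc cj; rewrite -ltnS prednK.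
  have [K _ /Ndom[lK rK _]] := CN _ (set_valP c).
  have /andP[h1 h2] := colN K _ (leq_trans (ltn0Sn _) lK) lK rK.
  by rewrite -ltnS; exact: leq_ltn_trans h1 h2.
suff : chain (rho j) [set z | [set x | inner (rho j) <= mdist x0 x] z /\
    col (rho j) z = k.+1] (set_val c) (set_val d) by exact: (colP (rho j)).2.
elim: cd => [a b [[/negP + ak] [/negP + bk] ab]|a|a b e _ IH1 _ IH2].
- rewrite -!leNgt => ra rb.
  have [->|/eqP aNb] := eqVneq a b; first exact: rt_refl.
  have aNb' : set_val a <> set_val b by move/val_inj.
  have [K _ NK] := CN _ (set_valP a); have [L _ NL] := CN _ (set_valP b).
  have abj : mdist (set_val a) (set_val b) <= rho j by exact: le_trans Dj.
  have bound i : rho i <= mdist (set_val a) (set_val b) -> (i <= j)%N.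
    by move=> h; rewrite leqNgt; apply/negP => /rho_lt; lra.
  have [Kj Lj] : (K <= j)%N /\ (L <= j)%N.
    have [KL|LK] := leqP K L.
      have Lj : (L <= j)%N by apply: bound; exact: Nsep NK NL aNb'.
      by split=> //; exact: leq_trans Lj.
    have Kj : (K <= j)%N.
      by apply: bound; rewrite metric_sym; exact: Nsep (ltnW LK) NL NK (nesym aNb').
    by split=> //; apply: leq_trans Kj; exact: ltnW.
  have [lK _ _] := Ndom _ _ NK; have [lL _ _] := Ndom _ _ NL.
  have lKj := leq_trans lK Kj; have lLj := leq_trans lL Lj.
  rewrite lKj in ak; rewrite lLj in bk.
  have /andP[a0 _] := colN j _ isT lKj ra; have /andP[b0 _] := colN j _ isT lLj rb.
  have inn z : rad j <= mdist x0 z -> inner (rho j) <= mdist x0 z.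
    by apply: le_trans; rewrite /rad le_max lexx.
  apply: rt_step; split; [|  |exact: abj].
    by split; [exact: inn|rewrite -ak prednK].
  by split; [exact: inn|rewrite -bk prednK].
- exact: rt_refl.
- exact: rt_trans IH1 IH2.
Qed.

End Hierarchy.

(** [P] is the union of the linked classes that meet [A3], and [C] is the
    skeleton, cut off near [A] and [B] so as to be far from both. *)
Lemma asdim_lt_asInd_lt (R : realType) (n : nat) (X : metricType R) :
  proper_metric X -> asdim_lt n X -> asInd_lt n X.
Proof.
elim: n X => [|n IH] X X_proper dimX.
  have [M [E [c [Eb [h _]]]]] := dimX 0.
  by apply: mboundedS Eb => x _; apply: contrapT => /h.
move=> A B /far_asymptotically_disjoint AB.
have [[x0 _]|nX] := pselect (exists x : X, True); last first.
  exists set0; split; first exact: closed0.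
    apply: (@asymptotic_separatorP _ _ X_proper A B set0 set0 set0).
    - by apply/seteqP; split=> x; case: nX; exists x.
    - exact/farC/far0.
    - exact/farC/far0.
    - exact/farC/far0.
    - exact/farC/far0.
    - by move=> r; exists 0; exists 0 => x; case: nX; exists x.
  apply: IH; first exact: proper_subspace closed0.
  move=> D; exists 0, setT, (fun=> 0%N).
  by split; [exists 0 => x|split=> [x|k x]]; case: nX; exists (set_val x).
have /choice[bnd] : forall D : R, exists M : R, exists r c, 0 <= M /\
    colouring D M n.+1 [set x | r <= mdist x0 x] c.
  move=> D; have [M [E [c [/(mbounded_ballP _ x0)[r hr] hc]]]] := dimX D.
  exists `|M|, r, c; split; first exact: normr_ge0.
  apply: colouringW hc => //; first exact: ler_norm.
  by move=> x /= rx /hr; apply/negP; rewrite -leNgt.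
move=> /choice[inner] /choice[col hcol].
have bnd0 D : 0 <= bnd D by case: (hcol D).
have colP D : colouring D (bnd D) n.+1 [set x | inner D <= mdist x0 x] (col D).
  by case: (hcol D).
pose A2 := closer A B; pose B2 := closer B A.
pose A3 := closer A2 B2.
have AB2 : far A2 B2 := far_closer AB.
have AB3 : far A3 B2 by apply: farS (far_closer AB2) => //; exact: sub_closer.
have /choice[psi hpsi] : forall t : R, exists r, forall a b,
    A3 a -> B2 b -> mdist a b < t -> mdist x0 a < r.
  move=> t; have /(mbounded_ballP _ x0)[r hr] := AB3 t.
  by exists r => a b Aa Bb ab; apply: hr; split=> //; exists b.
have [lev [levP lev_max]] := exists_level x0 bnd inner psi col.
pose P := [set x | exists2 a, A3 a & linked bnd lev a x].
have PB2 : far P B2 := far_linked bnd0 colP levP hpsi.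
have [N [Ndom Nsep Ncob]] := exists_skeleton x0 inner psi bnd0 lev.
pose C := \bigcup_K N K `\` (A2 `|` B2).
have Ccl : closed C.
  apply: closed_separated => x y [[J _ Nx] _] [[K _ Ny] _] xy.
  wlog JK : x y J K Nx Ny xy / (J <= K)%N.
    move=> h; have [|/ltnW] := leqP J K; first exact: h Nx Ny xy.
    by rewrite metric_sym; apply: h Ny Nx (nesym xy).
  apply: le_trans (Nsep _ _ _ _ JK Nx Ny xy).
  have [] := Ndom _ _ Ny; case: K {JK Ny} => [//|K] _ _ _.
  by apply: le_trans (rho_ge bnd0 K.+1); rewrite ler1n.
exists C; split=> //; last first.
  apply: IH; first exact: proper_subspace.
  apply: (asdim_lt_skeleton bnd0 colP lev_max Ndom Nsep).
  by move=> x [].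
have A3P : A3 `<=` P by move=> a Aa; exists a => //; exact: rt_refl.
have AA2 : A `<=` A2 := @sub_closer _ _ _ _.
have A23 : A2 `<=` A3 := @sub_closer _ _ _ _.
have BB2 : B `<=` B2 := @sub_closer _ _ _ _.
have A2Q : far A2 (~` P).
  by apply: farS (far_closerC AB2) => //; exact: subsetC.
apply: (@asymptotic_separatorP _ _ X_proper A B C P (~` P)) => //.
- exact: setUv.
- exact: farS A2Q.
- by apply: farS (far_closerC AB) => // x [_ nx] A2x; apply: nx; left.
- by apply/farC; apply: farS PB2.
- by apply: farS (far_closerC (farC AB)) => // x [_ nx] B2x; apply: nx; right.
move=> r; pose J := (Num.truncn r).+1.
have rJ : r <= rho bnd J by apply: le_trans (rho_ge bnd0 J); exact/ltW/truncnS_gt.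
have [s hs] := Ncob J.
pose s' := `|s| + `|r|.
have s1 := ler_norm s; have r1 := ler_norm r.
have s0 := normr_ge0 s; have r0 := normr_ge0 r.
exists s'.
have bA : metric_bounded [set p | exists2 c,
    A2 c /\ (exists2 q, (~` P) q & mdist c q < s' + r) & mdist p c <= s'].
  exact: mbounded_nbhd (A2Q (s' + r)) (fun p h => h).
have bB := PB2 s'.
have bx : metric_bounded [set p | mdist x0 p < s'].
  by apply/(mbounded_ballP _ x0); exists s'.
apply: mboundedS (mboundedU bx (mboundedU bA bB)) => p [Pp [q Qq pq] nC].
(* Were p and q both of level at least J, they would be linked. *)
have near : mdist x0 p < s' \/ exists2 c, (\bigcup_K N K) c & mdist p c < s'.
  have [pJ|pJ] := ltnP (lev p) J.
    by case: (hs p pJ) => [?|[c Nc pc]]; [left|right; exists c => //]; rewrite /s'; lra.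
  have [qJ|qJ] := ltnP (lev q) J; last first.
    exfalso; apply: Qq; case: Pp => a Aa ap; exists a => //.
    apply: (rt_trans _ _ _ _ _ ap); apply: rt_step; exists (maxn (lev p) (lev q)).
    split; rewrite ?leq_maxl ?leq_maxr ?andbT ?(leq_trans _ pJ) ?(leq_trans _ qJ)//.
    by apply: le_trans (ltW pq) (le_trans rJ _); apply: rho_le => //; rewrite leq_min pJ.
  case: (hs q qJ) => [xq|[c Nc qc]]; [left|right; exists c => //]; rewrite /s'.
    by have := metric_triangle x0 q p; rewrite (metric_sym q p); lra.
  by have := metric_triangle p q c; lra.
case: near => [xp|[c Nc pc]]; first by left.
right; have [A2c|nA2c] := pselect (A2 c).
  left; exists c; last exact: ltW.
  split=> //; exists q => //; have := metric_triangle c p q.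
  by rewrite (metric_sym c p); lra.
have [B2c|nB2c] := pselect (B2 c); first by right; split=> //; exists c.
by exfalso; apply: nC; exists c => //; split=> // -[].
Qed.
Theorem mainTheorem5 (R : realType) (X : metricType R)
  (X_proper : proper_metric X) (X_unbounded : ~ metric_bounded (@setT X))
  (X_asdim : (asdim X < +oo)%E) :
  asInd X = asdim X.
Proof.
have [_ [N /asdim_leP dimN _] _] := ereal_inf_lt X_asdim.
have ex : exists k, `[< asdim_lt k X >] by exists N.+1; apply/asboolP.
case: (ex_minnP ex) => -[|n] /asboolP dimn nmin.
  by case: X_unbounded; exact: asdim_lt_asInd_lt dimn.
have -> : asdim X = n%:R%:E.
  apply/eqP; rewrite eq_le; apply/andP; split.
    by apply: ereal_inf_lbound; exists n => //; exact/asdim_leP.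
  apply: le_ereal_inf_tmp => _ [m /asdim_leP dimm <-].
  by rewrite lee_fin ler_nat -ltnS; apply: nmin; apply/asboolP.
have nE : (n.+1%:R - 1)%:E = n%:R%:E :> \bar R by rewrite -natr1 addrK.
apply/eqP; rewrite eq_le; apply/andP; split.
  by rewrite -nE; apply: ereal_inf_lbound; exists n.+1 => //; exact: asdim_lt_asInd_lt.
apply: le_ereal_inf_tmp => _ [m indm <-]; rewrite -nE lee_fin lerD2r ler_nat.
rewrite leqNgt ltnS; apply/negP => mn.
have /asboolP/nmin := asInd_lt_asdim_lt X_proper indm mn dimn.
by rewrite ltnn.
Qed.
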